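(* Let $d\in\mathbb{N}$ and let $(x_i^{(k)})_{k=1}^d$, $i\in\mathbb{N}$, be free and identically distributed sets of $d$ self-adjoint non-zero random variables in some non-commutative $C^\ast$-probability space $(\mathcal{C},\tau)$, with $\tau$ faithful, such that $$\tau(x_i^{(k)})=0\quad\text{for } k=1,\dots,d \text{ and all } i\in\mathbb{N},\qquad \sup_{i\in\mathbb{N}}\max_{k=1,\dots,d}\|x_i^{(k)}\|<\infty .$$ Let $\Sigma=(\sigma_{k,l})_{k,l=1}^d$, $\sigma_{k,l}:=\tau(x_i^{(k)}x_i^{(l)})$, be their joint covariance matrix, and put $$S_n^{(k)}:=\frac{1}{\sqrt{n}}\sum_{i=1}^n x_i^{(k)}\qquad\text{for } k=1,\dots,d \text{ and all } n\in\mathbb{N}.$$ Then $(S_n^{(1)},\dots,S_n^{(d)})$ converges in distribution, as $n\to\infty$, to a semicircular family $(s_1,\dots,s_d)$ of covariance $\Sigma$. Moreover, let $p$ be a (not necessarily self-adjoint) polynomial in $d$ non-commuting variables and put $$P_n:=p(S_n^{(1)},\dots,S_n^{(d)})\qquad\text{and}\qquad P:=p(s_1,\dots,s_d).$$ Then there are constants $C>0$, $R>0$ and $N\in\mathbb{N}$ (depending on the polynomial) such that $$|G_P(z)-G_{P_n}(z)|\le C\,\frac{1}{\sqrt{n}}\qquad\text{for all } z\in\mathbb{C} \text{ with } |z|>R \text{ and all } n\ge N,$$ where $G_P$ and $G_{P_n}$ denote the scalar-valued Cauchy transforms of $P$ and of $P_n$, respectively.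
   Context: A non-commutative $C^\ast$-probability space $(\mathcal{C},\tau)$ is a unital $C^\ast$-algebra $\mathcal{C}$ with a state $\tau$. The sets $(x_i^{(k)})_{k=1}^d$, $i\in\mathbb{N}$, are free if the unital algebras $\mathcal{X}_i$ generated by $x_i^{(1)},\dots,x_i^{(d)}$ are freely independent with respect to $\tau$; they are identically distributed if for every non-commutative polynomial $q$ the value $\tau(q(x_i^{(1)},\dots,x_i^{(d)}))$ does not depend on $i$. Convergence in distribution means convergence of all joint moments: $\tau(S_n^{(k_1)}\cdots S_n^{(k_r)})\to\tau(s_{k_1}\cdots s_{k_r})$ for all $r$ and $k_1,\dots,k_r$. A semicircular family $(s_1,\dots,s_d)$ of covariance $\Sigma$ is a tuple of self-adjoint elements with $\tau(s_{k_1}\cdots s_{k_r})=\sum_{\pi}\prod_{\{a<b\}\in\pi}\sigma_{k_a,k_b}$, the sum over all non-crossing pairings $\pi$ of $\{1,\dots,r\}$. By convention $s_1,\dots,s_d$ are taken to live also in $(\mathcal{C},\tau)$, after enlarging $(\mathcal{C},\tau)$ if necessary. The scalar-valued Cauchy transform of $a\in\mathcal{C}$ is $G_a(z)=\tau[(z1-a)^{-1}]$, defined for all $z\in\mathbb{C}$ such that $z1-a$ is invertible in $\mathcal{C}$; the estimate includes that both Cauchy transforms are defined for $|z|>R$, $n\ge N$. *)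

(* Defs.v *)
From HB Require Import structures.
From mathcomp Require Import all_boot all_order all_algebra.
From mathcomp Require Import all_classical all_reals all_analysis.
From mathcomp Require Import complex.
From mathcomp Require monalg.
Export (canonicals, coercions) monalg.

Set Implicit Arguments.
Unset Strict Implicit.
Unset Printing Implicit Defensive.

Import Order.TTheory GRing.Theory Num.Theory.
Import numFieldNormedType.Exports.

Local Open Scope ring_scope.
Local Open Scope complex_scope.

(* Unital complex C*-algebras.  The norm is part of the mixin because the
   hierarchy admits no join of NormedZmodule with a ring structure above
   NumDomain.  Building on unitAlgType loses no generality: classically every
   algebra has that structure, and GRing.unit is exactly two-sided
   invertibility. *)
HB.mixin Record isCStarAlgebra (R : realType) A
    of GRing.UnitAlgebra R[i] A := {
  star : A -> A;
  cnorm : A -> R;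
  starK : involutive star;
  starD : {morph star : x y / x + y};
  starZ : forall (a : R[i]) (x : A), star (a *: x) = a^*%C *: star x;
  starM : forall x y : A, star (x * y) = star y * star x;
  cnorm_eq0 : forall x : A, cnorm x = 0 -> x = 0;
  cnormD : forall x y : A, cnorm (x + y) <= cnorm x + cnorm y;
  cnormZ : forall (a : R[i]) (x : A), cnorm (a *: x) = Normc.normc a * cnorm x;
  cnormM : forall x y : A, cnorm (x * y) <= cnorm x * cnorm y;
  cnorm_star : forall x : A, cnorm (star x * x) = cnorm x ^+ 2;
  cnorm_complete : forall u : nat -> A,
    (forall e : R, 0 < e -> exists N : nat, forall m n : nat,
       (N <= m)%N -> (N <= n)%N -> cnorm (u m - u n) < e) ->
    exists l : A, forall e : R, 0 < e -> exists N : nat, forall n : nat,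
       (N <= n)%N -> cnorm (u n - l) < e
}.

#[short(type="cstarAlgType")]
HB.structure Definition CStarAlgebra (R : realType) :=
  {A of isCStarAlgebra R A & GRing.UnitAlgebra R[i] A}.

(* Noncommutative polynomials: the algebra of the free monoid on 'I_d. *)
Definition ncpoly (R : realType) (d : nat) :=
  monalg.malg (monalg.fmonom 'I_d) R[i].

Definition nceval (R : realType) (A : cstarAlgType R) (d : nat)
    (p : ncpoly R d) (x : 'I_d -> A) : A :=
  monalg.mmap (in_alg A)
    (fun w : monalg.fmonom 'I_d => \prod_(k <- monalg.fmonom_val w) x k) p.

Section NonCrossing.
Local Open Scope set_scope.

Definition is_pairing (r : nat) (P : {set {set 'I_r}}) : bool :=
  finset.partition P [set: 'I_r] && [forall B in P, #|B| == 2%N].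

Definition is_noncrossing (r : nat) (P : {set {set 'I_r}}) : bool :=
  ~~ [exists a : 'I_r, exists b : 'I_r, exists c : 'I_r, exists e : 'I_r,
      [&& (a < b)%N, (b < c)%N, (c < e)%N,
          [set a; c] \in P & [set b; e] \in P]].

Definition semicircular_moment (R : realType) (d : nat)
    (Sigma : 'M[R[i]]_d) (r : nat) (k : 'I_r -> 'I_d) : R[i] :=
  \sum_(P : {set {set 'I_r}} | is_pairing P && is_noncrossing P)
    \prod_(ab : 'I_r * 'I_r | (ab.1 < ab.2)%N && ([set ab.1; ab.2] \in P))
      Sigma (k ab.1) (k ab.2).

End NonCrossing.

Local Open Scope classical_set_scope.

Section Probability.
Context {R : realType}.
Implicit Types A B : cstarAlgType R.

Definition self_adjoint A (a : A) : Prop := star a = a.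

Definition is_state A (tau : {scalar A}) : Prop :=
  (forall a : A, 0 <= tau (star a * a)) /\ tau 1 = 1.

Definition is_faithful A (tau : {scalar A}) : Prop :=
  forall a : A, tau (star a * a) = 0 -> a = 0.

Definition unital_subalgebra A (U : set A) : Prop :=
  [/\ U 1,
      (forall (c : R[i]) (u v : A), U u -> U v -> U (c *: u + v)) &
      (forall u v : A, U u -> U v -> U (u * v))].

Definition gen_alg A (X : set A) : set A :=
  smallest (@unital_subalgebra A) X.

Definition freely_independent A (tau : {scalar A}) (X : nat -> set A) : Prop :=
  forall (m : nat) (i : nat -> nat) (a : nat -> A),
    (0 < m)%N ->
    (forall j, (j < m)%N -> X (i j) (a j)) ->
    (forall j, (j < m)%N -> tau (a j) = 0) ->
    (forall j, (j.+1 < m)%N -> i j <> i j.+1) ->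
    tau (\prod_(j < m) a j) = 0.

Definition free_sets A (tau : {scalar A}) (d : nat)
    (x : nat -> 'I_d -> A) : Prop :=
  freely_independent tau (fun i => gen_alg (range (x i))).

Definition identically_distributed A (tau : {scalar A}) (d : nat)
    (x : nat -> 'I_d -> A) : Prop :=
  forall (q : ncpoly R d) (i j : nat),
    tau (nceval q (x i)) = tau (nceval q (x j)).

Definition semicircular_family A (tau : {scalar A}) (d : nat)
    (Sigma : 'M[R[i]]_d) (s : 'I_d -> A) : Prop :=
  (forall k, self_adjoint (s k)) /\
  forall (r : nat) (k : 'I_r -> 'I_d),
    tau (\prod_(j < r) s (k j)) = semicircular_moment Sigma k.

Definition converges_in_distribution A (tau : {scalar A}) B (phi : {scalar B})
    (d : nat) (S : nat -> 'I_d -> A) (s : 'I_d -> B) : Prop :=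
  forall (r : nat) (k : 'I_r -> 'I_d),
    (fun n : nat => tau (\prod_(j < r) S n (k j))) @ \oo -->
      (phi (\prod_(j < r) s (k j)) : R[i]^o).

Definition is_enlargement A (tau : {scalar A}) B (phi : {scalar B})
    (iota : {lrmorphism A -> B}) : Prop :=
  [/\ injective iota, (forall a, iota (star a) = star (iota a)) &
      (forall a, phi (iota a) = tau a)].

(* The variables are indexed from 0, so the n-th sum uses x 0, ..., x (n - 1). *)
Definition clt_sum A (d : nat) (x : nat -> 'I_d -> A) (n : nat) (k : 'I_d) : A :=
  ((Num.sqrt (n%:R : R))^-1)%:C *: \sum_(i < n) x i k.

Definition cauchy_defined A (a : A) (z : R[i]) : Prop :=
  (z%:A - a) \is a GRing.unit.

(* Meaningful only where cauchy_defined holds: x^-1 = x off the units. *)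
Definition cauchy_transform A (tau : {scalar A}) (a : A) (z : R[i]) : R[i] :=
  tau ((z%:A - a)^-1).

End Probability.

(* Main.v *)
(** For free centered self-adjoint [x_i] with [||x_i|| <= M], multiplication by
    [x_i] kills one of the four corners of the decomposition of alternating words
    according to whether they begin in the [i]-th algebra; summing over [i] gives
    [||x_0 + ... + x_(n-1)|| <= 2 M sqrt n], first on L2 and then in norm because
    the state is faithful.  Expanding [tau (S_n^(k_0) ... S_n^(k_r))] to first order
    in [x_i / sqrt n] gives the Schwinger-Dyson equation up to [O(1 / sqrt n)].
    Removing the block of the first point shows that the non-crossing pairing sums
    satisfy that equation exactly, so the moments of length [r] differ by at most
    [4 (12 M)^r / sqrt n].  This geometric growth survives summation of the Neumann
    series of the resolvents of [P] and [P_n] when [|z|] is large.  The semicircular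
    family is the sequence [(S_n)_n] itself, in the C*-algebra of bounded sequences
    with the limit of [tau] along an ultrafilter as state. *)
Require Import Defs.
From HB Require Import structures.
From mathcomp Require Import all_boot all_order all_algebra.
From mathcomp Require Import all_classical all_reals all_analysis.
From mathcomp Require Import complex ring lra zify.
From mathcomp Require monalg.
Import Order.TTheory GRing.Theory Num.Theory.
Import numFieldNormedType.Exports.
Set Implicit Arguments.
Unset Strict Implicit.
Unset Printing Implicit Defensive.
Local Open Scope ring_scope.
Local Open Scope complex_scope.

(** The trivial bound on [clt_sum] grows like [sqrt n], while the error estimates need bounds
    independent of [n], both for the full sum and for the sum with one variable deleted. These are
    [2 M] and [3 M], and [3 M] is used for both. In a word, the terms of order [1 / n], summed over
    the [n] variables, give the Schwinger-Dyson equation; those of order [n ^ (- 3 / 2)] leave the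
    error [1 / sqrt n]. The extra factor [4 ^ r] in [(12 M) ^ r] is the slack that closes the
    resulting recursion: a geometric sum of ratio 4 is at most a third of the next power. The
    passage from L2 to the operator norm, usually made in the GNS representation or by spectral
    theory, takes place inside [A] with square roots built by iteration. The comparison of Cauchy
    transforms sees the limit only through the moments and the norms of [s], so it applies to any
    semicircular family in any [B], not just to the one constructed. *)

Local Notation nc := Normc.normc.

(** * C*-algebras *)

Section ComplexModulus.
Variable R : rcfType.
Implicit Types (z : R[i]) (x : R).

Lemma normCE z : `|z| = (nc z)%:C.
Proof. by case: z. Qed.

Lemma nc_ge0 z : 0 <= nc z.
Proof. by case: z => a b /=; exact: sqrtr_ge0. Qed.

Lemma nc1 : nc (1 : R[i]) = 1.
Proof. exact: Normc.normc1. Qed.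

Lemma nc_real x : nc x%:C = `|x|.
Proof. by rewrite /nc /= expr0n addr0 sqrtr_sqr. Qed.

Lemma realCD x1 x2 : (x1 + x2)%:C = x1%:C + x2%:C.
Proof. exact: (rmorphD (real_complex R)). Qed.

Lemma realCB x1 x2 : (x1 - x2)%:C = x1%:C - x2%:C.
Proof. exact: (rmorphB (real_complex R)). Qed.

Lemma realCM x1 x2 : (x1 * x2)%:C = x1%:C * x2%:C.
Proof. exact: (rmorphM (real_complex R)). Qed.

Lemma nc_X z n : nc (z ^+ n) = nc z ^+ n.
Proof.
by elim: n => [|n ih]; rewrite ?expr0 ?Normc.normc1// !exprS Normc.normcM ih.
Qed.

Lemma nc_sum (I : Type) (s : seq I) (P : pred I) (F : I -> R[i]) :
  nc (\sum_(i <- s | P i) F i) <= \sum_(i <- s | P i) nc (F i).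
Proof.
elim/big_ind2: _ => [|a b c e ab ce|i _]; rewrite ?Normc.normc0//.
exact: le_trans (le_normcD _ _) (lerD ab ce).
Qed.

Lemma nc_Re z : `|complex.Re z| <= nc z.
Proof. by rewrite -lecR -normCE normc_ge_Re. Qed.

Lemma nc_Im z : `|complex.Im z| <= nc z.
Proof.
have e : complex.Re (- 'i%C * z) = complex.Im z by case: z => a b /=; ring.
rewrite -e; apply: le_trans (nc_Re _) _.
by rewrite Normc.normcM normcN /nc /= expr0n expr1n add0r sqrtr1 mul1r.
Qed.

Lemma nc_B z1 z2 : nc (z1 - z2) = nc (z2 - z1).
Proof. by rewrite -opprB normcN. Qed.

Lemma nc_tri z1 z2 : nc z1 <= nc z2 + nc (z1 - z2).
Proof. by rewrite -{1}(subrK z2 z1) addrC le_normcD. Qed.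

End ComplexModulus.

Lemma le_eps (R : realFieldType) (a b : R) :
  (forall e, 0 < e -> a <= b + e) -> a <= b.
Proof. by move=> h; apply/ler_addgt0Pr. Qed.

Section CStarBasics.
Variables (R : realType) (A : cstarAlgType R).
Implicit Types (a b u v g : A) (U : A -> Prop).

Lemma star_is_additive : {morph (@star R A) : x y / x - y}.
Proof.
move=> a b; rewrite starD -scaleN1r starZ; congr (_ + _).
by rewrite rmorphN rmorph1 scaleN1r.
Qed.

Lemma star0 : star (0 : A) = 0.
Proof. by have := star_is_additive (0 : A) 0; rewrite !subrr. Qed.

Lemma star1 : star (1 : A) = 1.
Proof. by have := starM (star (1 : A)) 1; rewrite mulr1 starK mulr1. Qed.

Lemma star_sum (I : Type) (s : seq I) (P : pred I) (F : I -> A) :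
  star (\sum_(i <- s | P i) F i) = \sum_(i <- s | P i) star (F i).
Proof. by apply: (big_morph _ (@starD R A)); rewrite star0. Qed.

Lemma star_realZ (x : R) a : star (x%:C *: a) = x%:C *: star a.
Proof. by rewrite starZ conjc_real. Qed.

Lemma cnorm0 : cnorm (0 : A) = 0.
Proof. by rewrite -(scale0r (0 : A)) cnormZ Normc.normc0 mul0r. Qed.

Lemma cnormN a : cnorm (- a) = cnorm a.
Proof. by rewrite -scaleN1r cnormZ normcN Normc.normc1 mul1r. Qed.

Lemma cnorm_ge0 a : 0 <= cnorm a.
Proof. by have := cnormD a (- a); rewrite subrr cnorm0 cnormN; lra. Qed.

Lemma cnormB a b : cnorm (a - b) = cnorm (b - a).
Proof. by rewrite -opprB cnormN. Qed.

Lemma cnorm_tri a b : cnorm a <= cnorm b + cnorm (a - b).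
Proof. by rewrite -{1}(subrK b a) addrC cnormD. Qed.

Lemma cnorm_realZ (x : R) a : 0 <= x -> cnorm (x%:C *: a) = x * cnorm a.
Proof. by move=> x0; rewrite cnormZ nc_real ger0_norm. Qed.

Lemma cnorm_starE a : cnorm (star a) = cnorm a.
Proof.
have le b : cnorm b <= cnorm (star b).
  have [->|nb] := eqVneq (cnorm b) 0; first exact: cnorm_ge0.
  have b0 : 0 < cnorm b by rewrite lt_neqAle eq_sym nb cnorm_ge0.
  by rewrite -(ler_pM2r b0) -expr2 -cnorm_star cnormM.
by apply/le_anti; rewrite le andbT -{2}[a]starK le.
Qed.

Lemma cnorm1 : cnorm (1 : A) = 1.
Proof.
have n0 : cnorm (1 : A) != 0.
  by apply/eqP => /cnorm_eq0/eqP; rewrite oner_eq0.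
by apply: (mulfI n0); rewrite mulr1 -expr2 -cnorm_star star1 mul1r.
Qed.

Lemma cnorm_X a n : cnorm (a ^+ n) <= cnorm a ^+ n.
Proof.
elim: n => [|n ih]; first by rewrite !expr0 cnorm1.
rewrite !exprS (le_trans (cnormM _ _))// ler_wpM2l ?cnorm_ge0//.
Qed.

Lemma cnorm_sum (I : Type) (s : seq I) (P : pred I) (F : I -> A) :
  cnorm (\sum_(i <- s | P i) F i) <= \sum_(i <- s | P i) cnorm (F i).
Proof.
elim/big_ind2: _ => [|a b c e ab ce|i _]; rewrite ?cnorm0//.
exact: le_trans (cnormD _ _) (lerD ab ce).
Qed.

Lemma cnorm_prod (I : Type) (s : seq I) (F : I -> A) (K : R) :
  (forall i, cnorm (F i) <= K) -> cnorm (\prod_(i <- s) F i) <= K ^+ size s.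
Proof.
move=> FK; elim: s => [|i s ih]; first by rewrite big_nil cnorm1.
rewrite big_cons /= exprS (le_trans (cnormM _ _))//.
by rewrite ler_pM ?cnorm_ge0.
Qed.

Lemma cnorm_small a : (forall e, 0 < e -> cnorm a <= e) -> a = 0.
Proof.
move=> h; apply: cnorm_eq0; apply/le_anti; rewrite cnorm_ge0 andbT.
by apply: le_eps => e e0; rewrite add0r h.
Qed.

(** * Closed subalgebras and commutants *)

Definition adherent U a := forall e : R, 0 < e -> exists2 u, U u & cnorm (u - a) < e.

(** For self-adjoint [g], lying in every closed subalgebra that contains [g] means being a
    continuous function of [g]. The square roots below are delivered with this property, which gives
    their commutation relations. *)
Definition closed_subalgebra U :=
  @unital_subalgebra R A U /\ forall a, adherent U a -> U a.

Lemma subalg_D U u v : @unital_subalgebra R A U -> U u -> U v -> U (u + v).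
Proof. by move=> [_ l _] hu hv; rewrite -[u]scale1r; apply: l. Qed.

Lemma subalg_0 U : @unital_subalgebra R A U -> U 0.
Proof. by move=> [U1 Ul _]; rewrite -(subrr 1) addrC -scaleN1r; apply: Ul. Qed.

Lemma subalg_Z U (c : R[i]) u : @unital_subalgebra R A U -> U u -> U (c *: u).
Proof. by move=> hU hu; rewrite -[_ *: _]addr0; case: hU (subalg_0 hU) => _ + _; apply. Qed.

Lemma subalg_B U u v : @unital_subalgebra R A U -> U u -> U v -> U (u - v).
Proof. by move=> hU hu hv; rewrite -scaleN1r; apply: subalg_D => //; apply: subalg_Z. Qed.

Lemma adherent_lin U (V W : A -> Prop) (c : R[i]) a b :
  (forall u v, U u -> V v -> W (c *: u + v)) ->
  adherent U a -> adherent V b -> adherent W (c *: a + b).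
Proof.
move=> h ha hb e e0.
have k0 : 0 < 2 * (nc c + 1) by rewrite mulr_gt0// ltr_wpDl// nc_ge0.
have [u hu ua] := ha (e / (2 * (nc c + 1))) (divr_gt0 e0 k0).
have [v hv vb] := hb (e / 2) (divr_gt0 e0 (ltr0n _ 2)).
exists (c *: u + v); first exact: h.
have -> : c *: u + v - (c *: a + b) = c *: (u - a) + (v - b).
  by rewrite scalerBr opprD addrACA.
apply: le_lt_trans (cnormD _ _) _; rewrite cnormZ.
have : nc c * cnorm (u - a) <= (nc c + 1) * (e / (2 * (nc c + 1))).
  by rewrite ler_pM ?nc_ge0 ?cnorm_ge0 ?ltW// ltrDl.
have -> : (nc c + 1) * (e / (2 * (nc c + 1))) = e / 2.
  rewrite invfM; field; rewrite gt_eqF//=; have := nc_ge0 c; lra.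
lra.
Qed.

Lemma adherent_mul U a b :
  (forall u v, U u -> U v -> U (u * v)) ->
  adherent U a -> adherent U b -> adherent U (a * b).
Proof.
move=> h ha hb e e0.
have k0 : 0 < 2 * (cnorm b + 1) by rewrite mulr_gt0// ltr_wpDl// cnorm_ge0.
have [u hu ua] := ha (e / (2 * (cnorm b + 1))) (divr_gt0 e0 k0).
(* [v] is chosen after [u], so its tolerance may depend on [u]. *)
have l0 : 0 < 2 * (cnorm u + 1) by rewrite mulr_gt0// ltr_wpDl// cnorm_ge0.
have [v hv vb] := hb (e / (2 * (cnorm u + 1))) (divr_gt0 e0 l0).
exists (u * v); first exact: h.
have -> : u * v - a * b = u * (v - b) + (u - a) * b.
  by rewrite mulrBr mulrBl addrA subrK.
apply: le_lt_trans (cnormD _ _) _.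
have h1 : cnorm (u * (v - b)) < e / 2.
  apply: le_lt_trans (cnormM _ _) _.
  apply: le_lt_trans (_ : (cnorm u + 1) * cnorm (v - b) < _).
    by rewrite ler_wpM2r ?cnorm_ge0// lerDl.
  have p : 0 < cnorm u + 1 by rewrite ltr_wpDl// cnorm_ge0.
  rewrite -ltr_pdivlMl// (lt_le_trans vb)// invfM mulrA mulrC.
  by [].
have h2 : cnorm ((u - a) * b) <= e / 2.
  apply: le_trans (cnormM _ _) _.
  apply: le_trans (_ : cnorm (u - a) * (cnorm b + 1) <= _).
    by rewrite ler_wpM2l ?cnorm_ge0// lerDl.
  have p : 0 < cnorm b + 1 by rewrite ltr_wpDl// cnorm_ge0.
  by rewrite -ler_pdivlMr// (le_trans (ltW ua))// invfM mulrA.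
by have := ltr_leD h1 h2; lra.
Qed.

Lemma adherent_of U a : U a -> adherent U a.
Proof. by move=> h e e0; exists a; rewrite // subrr cnorm0. Qed.

Lemma adherent_closed U a : adherent (adherent U) a -> adherent U a.
Proof.
move=> h e e0; have e2 : 0 < e / 2 by rewrite divr_gt0.
have [u hu ua] := h _ e2; have [v hv vu] := hu _ e2.
exists v => //; have -> : v - a = (v - u) + (u - a) by rewrite addrA subrK.
apply: le_lt_trans (cnormD _ _) _; lra.
Qed.

Lemma closure_subalgebra U :
  @unital_subalgebra R A U -> closed_subalgebra (adherent U).
Proof.
move=> [U1 Ul Um]; split; last exact: adherent_closed.
split; [exact: adherent_of| |].
  by move=> c u v; apply: adherent_lin => a b; apply: Ul.
by move=> a b; apply: adherent_mul.
Qed.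

(** Multiplication by a fixed [u] on either side is Lipschitz, so commutation survives limits. Hence
    whatever commutes with [g] commutes with the roots built from [g]. *)
Lemma commutant_closed (S : A -> Prop) :
  closed_subalgebra (fun v => forall u, S u -> GRing.comm v u).
Proof.
split=> [|a h u hu].
  split=> [u _|c u v cu cv w hw|u v cu cv w hw].
  - by rewrite /GRing.comm mulr1 mul1r.
  - by rewrite /GRing.comm mulrDl mulrDr -scalerAl -scalerAr cu// cv.
  - by rewrite /GRing.comm -mulrA cv// mulrA cu// mulrA.
apply/eqP; rewrite -subr_eq0; apply/eqP/cnorm_small => e e0.
have k0 : 0 < 2 * (cnorm u + 1) by rewrite mulr_gt0// ltr_wpDl// cnorm_ge0.
have [v hv va] := h _ (divr_gt0 e0 k0).
have -> : a * u - u * a = u * (v - a) - (v - a) * u.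
  by rewrite mulrBr mulrBl hv// opprB [RHS]addrC addrA subrK.
apply: le_trans (cnormD _ _) _; rewrite cnormN.
apply: le_trans (lerD (cnormM _ _) (cnormM _ _)) _.
have : cnorm (v - a) * (cnorm u + 1) <= e / 2.
  have p : 0 < cnorm u + 1 by rewrite ltr_wpDl// cnorm_ge0.
  by rewrite -ler_pdivlMr// (le_trans (ltW va))// invfM mulrA.
have := cnorm_ge0 (v - a); lra.
Qed.

Definition limit_of (y : nat -> A) l := forall e : R, 0 < e ->
  exists N : nat, forall n : nat, (N <= n)%N -> cnorm (y n - l) < e.

Lemma limit_adherent U y l : (forall n, U (y n)) -> limit_of y l -> adherent U l.
Proof.
by move=> hy hl e e0; have [N hN] := hl _ e0; exists (y N) => //; exact: hN.
Qed.

Lemma cnorm_adherent U (K : R) a :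
  (forall u, U u -> cnorm u <= K) -> adherent U a -> cnorm a <= K.
Proof.
move=> h ha; apply: le_eps => e e0; have [u hu ua] := ha _ e0.
have := cnorm_tri a u; rewrite cnormB; have := h _ hu; lra.
Qed.

Lemma self_adjoint_adherent U a :
  (forall u, U u -> self_adjoint u) -> adherent U a -> self_adjoint a.
Proof.
move=> h ha; apply/eqP; rewrite -subr_eq0; apply/eqP/cnorm_small => e e0.
have [u /h hu ua] := ha _ (divr_gt0 e0 (ltr0n _ 2)).
have -> : star a - a = star (a - u) + (u - a).
  by rewrite star_is_additive hu addrA subrK.
apply: le_trans (cnormD _ _) _; rewrite cnorm_starE cnormB; lra.
Qed.

Lemma dominated_dist (y : nat -> A) (t : nat -> R) m n :
  (forall k, cnorm (y k.+1 - y k) <= t k.+1 - t k) -> (m <= n)%N ->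
  cnorm (y n - y m) <= t n - t m.
Proof.
move=> dom /subnK <-; elim: (n - m)%N => [|k ih]; first by rewrite !subrr cnorm0.
rewrite addSn -(subrK (y (k + m)%N) (y (k + m).+1)) -addrA.
apply: le_trans (cnormD _ _) _; have := dom (k + m)%N; lra.
Qed.

(** The increments of [t] dominate norms, so [t] is nondecreasing; being bounded it converges, and
    [y] inherits its Cauchy property. This serves both the square-root iteration and the Neumann
    series. *)
Lemma dominated_limit (y : nat -> A) (t : nat -> R) (K : R) :
  (forall k, cnorm (y k.+1 - y k) <= t k.+1 - t k) -> (forall k, t k <= K) ->
  exists l, limit_of y l.
Proof.
move=> dom tK; apply: cnorm_complete => e e0.
have /cvg_ex[l tl] : cvgn t.
  apply: nondecreasing_is_cvgn; last by exists K => _ [n _ <-].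
  apply/nondecreasing_seqP => n; rewrite -subr_ge0.
  exact: le_trans (cnorm_ge0 _) (dom n).
have /cvgrPdist_lt/(_ _ (divr_gt0 e0 (ltr0n _ 2)))[N _ hN] := tl.
exists N => m n Nm Nn.
wlog mn : m n Nm Nn / (m <= n)%N => [hw|].
  by case/orP: (leq_total m n) => h; [|rewrite cnormB]; apply: hw.
rewrite cnormB; apply: le_lt_trans (dominated_dist dom mn) _.
have hm := hN m Nm; have hn := hN n Nn.
have -> : t n - t m = (l - t m) - (l - t n) by ring.
apply: le_lt_trans (ler_norm _) _.
by apply: le_lt_trans (ler_normB _ _) _; lra.
Qed.

(** * Square roots by iteration *)

Fixpoint sqrt_scal (n : nat) : R :=
  if n is m.+1 then (1 + sqrt_scal m ^+ 2) / 2 else 0.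

Fixpoint sqrt_iter g (n : nat) : A :=
  if n is m.+1 then (2^-1 : R)%:C *: (g + sqrt_iter g m ^+ 2) else 0.

Lemma sqrt_scal_itv n : 0 <= sqrt_scal n <= 1.
Proof.
elim: n => [|n /andP[h0 h1]]; first by rewrite lexx ler01.
by rewrite /=; apply/andP; split; nra.
Qed.

Lemma sqrt_iter_mem U g n : @unital_subalgebra R A U -> U g -> U (sqrt_iter g n).
Proof.
move=> hU Ug; elim: n => [|n ih] /=; first exact: subalg_0.
apply: subalg_Z => //; apply: subalg_D => //.
by rewrite expr2; case: hU => _ _; apply.
Qed.

Lemma comm_sqrt_iter g u n : GRing.comm u g -> GRing.comm u (sqrt_iter g n).
Proof.
move=> ug; apply/esym.
have [hU _] := commutant_closed (fun v => v = u).
by apply: (sqrt_iter_mem n hU) => // v ->.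
Qed.

(** The iterates are polynomials in [g], hence commute, so the difference of two squares factors and
    each increment is half the previous one times the sum of the two iterates. The scalar sequence
    satisfies the same recursion, and the comparison goes by induction. *)
Lemma sqrt_iter_bound g n : cnorm g <= 1 ->
  cnorm (sqrt_iter g n) <= sqrt_scal n /\
  cnorm (sqrt_iter g n.+1 - sqrt_iter g n) <= sqrt_scal n.+1 - sqrt_scal n.
Proof.
move=> g1.
have norms m : cnorm (sqrt_iter g m) <= sqrt_scal m.
  elim: m => [|m ih] /=; first by rewrite cnorm0.
  rewrite cnorm_realZ ?invr_ge0// mulrC ler_pM2r ?invr_gt0//.
  apply: le_trans (cnormD _ _) (lerD g1 _).
  apply: le_trans (cnorm_X _ _) _.
  by rewrite lerXn2r ?nnegrE ?cnorm_ge0//; case/andP: (sqrt_scal_itv m).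
split => //.
elim: n => [|n ih].
  rewrite /= !subr0 expr0n addr0 cnorm_realZ ?invr_ge0// expr0n/= addr0 mul1r.
  by rewrite ler_piMr ?invr_ge0.
set y := sqrt_iter g; set t := sqrt_scal.
have yy : GRing.comm (y n) (y n.+1).
  by apply/comm_sqrt_iter/esym/comm_sqrt_iter.
have -> : y n.+2 - y n.+1 = (2^-1 : R)%:C *: ((y n.+1 - y n) * (y n.+1 + y n)).
  rewrite [y n.+2]/= -/y [X in _ - X]/= -/y -scalerBr; congr (_ *: _).
  rewrite opprD addrACA subrr add0r mulrBl !mulrDr -!expr2 yy opprD addrA.
  by rewrite -[(_ + y n.+1 * y n) - _]addrA subrr addr0.
have -> : t n.+2 - t n.+1 = 2^-1 * ((t n.+1 - t n) * (t n.+1 + t n)).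
  have -> : t n.+2 = (1 + t n.+1 ^+ 2) / 2 by [].
    by have -> : t n.+1 = (1 + t n ^+ 2) / 2 by []; field.
rewrite cnorm_realZ ?invr_ge0// ler_pM2l ?invr_gt0//.
apply: le_trans (cnormM _ _) _; rewrite ler_pM ?cnorm_ge0//.
by apply: le_trans (cnormD _ _) (lerD (norms _) (norms _)).
Qed.

(* The iteration [y <- (g + y^2)/2] is dominated by the scalar one, whose
   increments are summable; its limit solves [(1 - y)^2 = 1 - g]. *)
Lemma sqrt_one_minus g : self_adjoint g -> cnorm g <= 1 -> exists y,
  [/\ self_adjoint y, cnorm y <= 1, (1 - y) ^+ 2 = 1 - g &
      forall U, closed_subalgebra U -> U g -> U y].
Proof.
move=> gsa g1.
have [l hl] : exists l, limit_of (sqrt_iter g) l.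
  apply: (dominated_limit (t := sqrt_scal) (K := 1)) => n.
    exact: (sqrt_iter_bound n g1).2.
  by case/andP: (sqrt_scal_itv n).
exists l.
have adh U : (forall n, U (sqrt_iter g n)) -> adherent U l.
  by move=> h; apply: limit_adherent hl.
have l1 : cnorm l <= 1.
  apply: (@cnorm_adherent (fun u => cnorm u <= 1)) => //; apply: adh => n.
  by apply: le_trans (sqrt_iter_bound n g1).1 _; case/andP: (sqrt_scal_itv n).
split => //.
- apply: (@self_adjoint_adherent (@self_adjoint R A)) => //; apply: adh.
  elim=> [|n ih] /=; rewrite /self_adjoint ?star0// star_realZ starD gsa.
  by rewrite !expr2 starM ih.
- suff E : l = (2^-1 : R)%:C *: (g + l ^+ 2).
    have E2 : l + l = g + l ^+ 2.
      rewrite {1 2}E -scalerDl -rmorphD/=.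
      by have -> : 2^-1 + 2^-1 = 1 :> R by [lra]; rewrite scale1r.
    rewrite expr2 mulrBl !mulrBr !mul1r mulr1 -expr2.
    have -> : g = l + l - l ^+ 2 by rewrite E2 addrK.
    by rewrite -addrA -opprD addrA.
  apply/eqP; rewrite -subr_eq0; apply/eqP/cnorm_small => e e0.
  have [N hN] := hl (e / 4) (divr_gt0 e0 (ltr0n _ 4)).
  have h1 := hN N (leqnn _); have h2 := hN N.+1 (leqnSn _).
  have y1 : cnorm (sqrt_iter g N) <= 1.
    by apply: le_trans (sqrt_iter_bound N g1).1 _; case/andP: (sqrt_scal_itv N).
  set y := sqrt_iter g in h1 h2 y1.
  have -> : l - (2^-1 : R)%:C *: (g + l ^+ 2) =
    - (y N.+1 - l) + (2^-1 : R)%:C *: (y N * (y N - l) + (y N - l) * l).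
    have -> : y N.+1 = (2^-1 : R)%:C *: (g + y N ^+ 2) by [].
    rewrite mulrBl mulrBr addrA subrK -!expr2 opprB -addrA.
    congr (_ + _); rewrite -!scalerN -scalerDr; congr (_ *: _).
    by rewrite !opprD -addrA (addrA (- y N ^+ 2)) addNr add0r.
  apply: le_trans (cnormD _ _) _; rewrite cnormN cnorm_realZ ?invr_ge0//.
  have hh := cnormD (y N * (y N - l)) ((y N - l) * l).
  have k1 := cnormM (y N) (y N - l); have k2 := cnormM (y N - l) l.
  have k3 := cnorm_ge0 (y N - l).
  have k4 : cnorm (y N) * cnorm (y N - l) <= cnorm (y N - l) by rewrite ler_piMl.
  have k5 : cnorm (y N - l) * cnorm l <= cnorm (y N - l) by rewrite ler_piMr.
  lra.
- move=> U [Usub Ucl] Ug; apply: Ucl; apply: adh => n.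
  exact: sqrt_iter_mem.
Qed.

(* [h + i c] is a multiple of a unitary and [h] is its real part. *)
Lemma cnorm_le_of_sum_squares (K : R) (h c : A) : self_adjoint h -> self_adjoint c ->
  GRing.comm h c -> 0 <= K -> h ^+ 2 + c ^+ 2 = (K ^+ 2)%:C *: 1 -> cnorm h <= K.
Proof.
move=> hsa csa hc K0 e.
pose u := h + 'i%C *: c; pose v := h - 'i%C *: c.
have vE : star u = v.
  by rewrite /u /v starD starZ hsa csa -scaleNr; congr (_ + _ *: _); simpc.
have vu : v * u = (K ^+ 2)%:C *: 1.
  rewrite -e /u /v mulrBl !mulrDr -!scalerAl -!scalerAr hc.
  rewrite opprD addrA addrK -!expr2; congr (_ + _).
  by rewrite scalerA -expr2 sqr_i scaleN1r opprK.
have nu : cnorm u <= K.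
  rewrite -(@ler_pXn2r _ 2) ?nnegrE ?cnorm_ge0// -cnorm_star vE vu.
  by rewrite cnorm_realZ ?sqr_ge0// cnorm1 mulr1.
have hE : h = (2^-1 : R)%:C *: (u + v).
  rewrite /u /v addrACA subrr addr0 -{1}[h]scale1r -{2 3}[h]scale1r.
  rewrite -scalerDl scalerA; congr (_ *: _).
  by rewrite -[1]/(1%:C : R[i]) -rmorphD -rmorphM/=; congr _%:C; field.
rewrite hE cnorm_realZ ?invr_ge0//.
have := cnormD u v; rewrite -{2}vE cnorm_starE; lra.
Qed.

Lemma comm_closed_of g (y u : A) :
  (forall U, closed_subalgebra U -> U g -> U y) -> GRing.comm g u -> GRing.comm y u.
Proof.
move=> hy gu; apply: (hy _ (commutant_closed (fun v => v = u))) => // v -> //.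
Qed.

(** With [c = 1 - y] a square root of [1 - h ^+ 2], the squares of [c] and [h] add up to 1, so [c]
    has norm at most 1 and so has its square. This replaces an appeal to the spectrum of [h]. *)
Lemma cnorm_one_minus_sq (h : A) : self_adjoint h -> cnorm h <= 1 -> cnorm (1 - h ^+ 2) <= 1.
Proof.
move=> hsa h1.
have gsa : self_adjoint (h ^+ 2) by rewrite /self_adjoint expr2 starM hsa.
have g1 : cnorm (h ^+ 2) <= 1 by apply: le_trans (cnorm_X _ _) _; rewrite exprn_ile1 ?cnorm_ge0.
have [y [ysa y1 ey hy]] := sqrt_one_minus gsa g1.
have csa : self_adjoint (1 - y) by rewrite /self_adjoint star_is_additive star1 ysa.
have hh : GRing.comm (h ^+ 2) h by rewrite /GRing.comm -exprSr -exprS.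
have yh := comm_closed_of hy hh.
rewrite -ey; apply: le_trans (cnorm_X _ _) _; rewrite exprn_ile1 ?cnorm_ge0//.
apply: (@cnorm_le_of_sum_squares 1 _ h) => //.
  by rewrite /GRing.comm mulrBl mulrBr mulr1 mul1r yh.
by rewrite ey subrK expr1n scale1r.
Qed.

(** [b] is the square root of the absolute value of [h]. After rescaling [h] to [h'] of norm at most
    1, [1 - y] is the absolute value of [h'], and [1 - c] is the square root of [1 - y]. The summand
    1 in [K] keeps [K] invertible when [h = 0]. *)
Lemma sqr_has_fourth_root (h : A) : self_adjoint h -> exists b, [/\ self_adjoint b,
  b ^+ 4 = h ^+ 2 & forall U, closed_subalgebra U -> U h -> U b].
Proof.
move=> hsa; pose K := cnorm h + 1.
have K0 : 0 < K by rewrite ltr_wpDl// cnorm_ge0.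
have nz : (K%:C : R[i]) != 0 by rewrite -(rmorph0 (real_complex R)) (inj_eq (@complexI _)) gt_eqF.
pose h' := K^-1%:C *: h.
have h'sa : self_adjoint h' by rewrite /self_adjoint star_realZ hsa.
have h'1 : cnorm h' <= 1.
  by rewrite cnorm_realZ ?invr_ge0 ?(ltW K0)// ler_pdivrMl// mulr1 lerDl.
have gsa : self_adjoint (1 - h' ^+ 2).
  by rewrite /self_adjoint star_is_additive star1 expr2 starM h'sa.
have [y [ysa y1 ey hy]] := sqrt_one_minus gsa (cnorm_one_minus_sq h'sa h'1).
have [c [csa c1 ec hc]] := sqrt_one_minus ysa y1.
exists ((Num.sqrt K)%:C *: (1 - c)); split.
- by rewrite /self_adjoint star_realZ star_is_additive star1 csa.
- rewrite exprZn (exprM (1 - c) 2 2) ec ey subKr -rmorphXn.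
  rewrite (exprM (Num.sqrt K) 2 2) sqr_sqrtr ?(ltW K0)//.
  rewrite /h' exprZn scalerA -rmorphXn -rmorphM -exprMn divff ?expr1n ?scale1r//.
  by rewrite gt_eqF.
- move=> U cU Uh; have [sU _] := cU; have [U1 _ Um] := sU.
  apply: subalg_Z => //; apply: subalg_B => //; apply: hc => //; apply: hy => //.
  apply: subalg_B => //; rewrite expr2; apply: Um; exact: subalg_Z.
Qed.

End CStarBasics.
(** * States and the L2 norm *)

Section States.
Variables (R : realType) (A : cstarAlgType R) (tau : {scalar A}).
Hypothesis htau : is_state tau.
Implicit Types (a b u v x : A).

Lemma stateZ (c : R[i]) a : tau (c *: a) = c * tau a.
Proof. exact: linearZ. Qed.

Lemma stateD a b : tau (a + b) = tau a + tau b.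
Proof. exact: linearD. Qed.

Lemma stateB a b : tau (a - b) = tau a - tau b.
Proof. exact: linearB. Qed.

Lemma state_sum (I : Type) (s : seq I) (P : pred I) (F : I -> A) :
  tau (\sum_(i <- s | P i) F i) = \sum_(i <- s | P i) tau (F i).
Proof. exact: linear_sum. Qed.

(** Positivity makes [tau (star b * b)] real. Taking [b = 1 + a] settles the imaginary part, and
    [b = 1 + 'i *: a] the real part. *)
Lemma state_star a : tau (star a) = (tau a)^*%C.
Proof.
have pos := htau.1.
have real z : 0 <= z :> R[i] -> complex.Im z = 0 by rewrite lecE => /andP[/eqP].
have e1 := real _ (pos (1 + a)); have e2 := real _ (pos (1 + 'i%C *: a)).
have e0 := real _ (pos a).
have t1 := htau.2.
rewrite starD star1 mulrDl !mulrDr !mul1r mulr1 !stateD t1 in e1.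
rewrite starD star1 starZ mulrDl !mulrDr !mul1r mulr1 !stateD t1 in e2.
rewrite -!scalerAl -!scalerAr scalerA !stateZ in e2.
move: e0 e1 e2; case: (tau a) (tau (star a)) (tau (star a * a)) => [p q] [p' q'] [r s] /= -> h1 h2.
by apply/eqP; rewrite eq_complex /=; apply/andP; split; apply/eqP; lra.
Qed.

(** The squared GNS norm of [tau], kept on [A] itself without completing to a Hilbert space. *)
Definition sqn a : R := complex.Re (tau (star a * a)).
Definition l2 a : R := Num.sqrt (sqn a).

Lemma sqnE a : tau (star a * a) = (sqn a)%:C.
Proof.
have := htau.1 a; rewrite lecE /sqn => /andP[/eqP h _].
by apply/eqP; rewrite eq_complex /= h eqxx /=.
Qed.

Lemma sqn_ge0 a : 0 <= sqn a.
Proof. by have := htau.1 a; rewrite sqnE ler0c. Qed.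

Lemma l2_ge0 a : 0 <= l2 a. Proof. exact: sqrtr_ge0. Qed.

Lemma l2_sq a : l2 a ^+ 2 = sqn a.
Proof. by rewrite sqr_sqrtr // sqn_ge0. Qed.

Lemma state_swap a b : tau (star a * b) = (tau (star b * a))^*%C.
Proof. by rewrite -state_star starM starK. Qed.

Lemma cauchy_schwarz a b : nc (tau (star b * a)) <= l2 a * l2 b.
Proof.
set t := tau _; have [T T_def] : {T | T = nc t ^+ 2} by exists (nc t ^+ 2).
(* The factor [t] beside the real parameter [s] aligns the phases, so one real quadratic in [s] is
   enough. *)
have key (s : R) : 0 <= sqn a - 2 * s * T + s ^+ 2 * T * sqn b.
  have := sqn_ge0 (a - (s%:C * t) *: b); congr (0 <= _).
  apply: complexI; rewrite -sqnE star_is_additive mulrBl !mulrBr starZ.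
  rewrite -!scalerAl -!scalerAr scalerA !stateB !stateZ -/t.
  rewrite (state_swap a b) -/t !sqnE.
  have TE : T%:C = t * t^*%C by rewrite T_def rmorphXn/= -normCE sqr_normc.
  have sJ : (s%:C * t)^*%C = s%:C * t^*%C by rewrite rmorphM; congr (_ * _); exact: conjc_real.
  rewrite sJ realCD realCB !realCM TE (rmorph_nat (real_complex R)); ring.
have T0 : 0 <= T by rewrite T_def sqr_ge0.
rewrite -(@ler_pXn2r _ 2) ?nnegrE ?mulr_ge0 ?nc_ge0 ?l2_ge0// exprMn !l2_sq -T_def.
have p0 := sqn_ge0 a; have q0 := sqn_ge0 b.
have [qz|qn] := eqVneq (sqn b) 0.
  rewrite qz mulr0 leNgt; apply/negP => Tp.
  (* If [sqn b = 0] the quadratic is affine in [s], and this [s] makes it negative unless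
     [T = 0]. *)
  have := key ((sqn a + 1) / T); rewrite qz mulr0 addr0.
  have -> : 2 * ((sqn a + 1) / T) * T = 2 * (sqn a + 1) by field; rewrite gt_eqF.
  lra.
have q1 : 0 < sqn b by rewrite lt_neqAle eq_sym qn.
have := key (sqn b)^-1.
have -> : sqn a - 2 * (sqn b)^-1 * T + (sqn b)^-1 ^+ 2 * T * sqn b = sqn a - T / sqn b.
  by field.
by rewrite subr_ge0 ler_pdivrMr.
Qed.

Lemma sqnD a b : sqn (a + b) = sqn a + sqn b + 2 * complex.Re (tau (star b * a)).
Proof.
rewrite /sqn starD mulrDl !mulrDr !raddfD /= (state_swap a b).
by case: (tau (star b * a)) => p q /=; ring.
Qed.

Lemma l2D a b : l2 (a + b) <= l2 a + l2 b.
Proof.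
rewrite -(@ler_pXn2r _ 2) ?nnegrE ?addr_ge0 ?l2_ge0// l2_sq sqnD sqrrD !l2_sq.
have := cauchy_schwarz a b; have := nc_Re (tau (star b * a)).
have := ler_norm (complex.Re (tau (star b * a))); lra.
Qed.

Lemma l2Z (c : R[i]) a : l2 (c *: a) = nc c * l2 a.
Proof.
apply/eqP; rewrite -(@eqrXn2 _ 2) ?mulr_ge0 ?nc_ge0 ?l2_ge0// exprMn !l2_sq.
apply/eqP/complexI; rewrite -sqnE starZ -scalerAl -scalerAr scalerA stateZ sqnE.
by rewrite rmorphM rmorphXn /= -normCE sqr_normc [c^*%C * c]mulrC.
Qed.

Lemma l2N a : l2 (- a) = l2 a.
Proof. by rewrite -scaleN1r l2Z normcN Normc.normc1 mul1r. Qed.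

Lemma l2_orthD a b : tau (star b * a) = 0 -> l2 (a + b) ^+ 2 = l2 a ^+ 2 + l2 b ^+ 2.
Proof. by move=> e; rewrite !l2_sq sqnD e /= mulr0 addr0. Qed.

(** With [g = star a * a / K ^+ 2] and [1 - y] a square root of [1 - g], the defect between
    [K ^+ 2 * sqn x] and [sqn (a * x)] is [K ^+ 2 * sqn ((1 - y) * x)], which is nonnegative. *)
Lemma l2_mulr a x : l2 (a * x) <= cnorm a * l2 x.
Proof.
have [->|na] := eqVneq a 0.
  by rewrite mul0r cnorm0 mul0r -(scale0r (0 : A)) l2Z Normc.normc0 mul0r.
set K := cnorm a.
have K0 : 0 < K by rewrite lt_neqAle cnorm_ge0 andbT eq_sym; apply: contra na => /eqP/cnorm_eq0 ->.
pose g := (K ^- 2)%:C *: (star a * a).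
have gsa : self_adjoint g by rewrite /self_adjoint star_realZ starM starK.
have g1 : cnorm g <= 1.
  rewrite cnorm_realZ ?invr_ge0 ?sqr_ge0// cnorm_star -/K mulVf// sqrf_eq0 gt_eqF//.
have [y [ysa _ ey _]] := sqrt_one_minus gsa g1.
have csa : star (1 - y) = 1 - y by rewrite star_is_additive star1 ysa.
rewrite -(@ler_pXn2r _ 2) ?nnegrE ?mulr_ge0 ?l2_ge0 ?cnorm_ge0// exprMn !l2_sq.
have E : sqn (a * x) = K ^+ 2 * (sqn x - sqn ((1 - y) * x)).
  apply: complexI; rewrite rmorphM rmorphB /= -!sqnE !starM csa.
  rewrite -!mulrA (mulrA (1 - y)) -expr2 ey mulrBl (mulrBr (star x)) stateB mul1r subKr.
  rewrite /g -scalerAl -scalerAr stateZ [RHS]mulrA -realCM mulfV ?mul1r -?(mulrA (star a))//.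
  by rewrite sqrf_eq0 gt_eqF.
by rewrite E ler_wpM2l ?sqr_ge0// gerBl sqn_ge0.
Qed.

Lemma l2_1 : l2 1 = 1.
Proof. by rewrite /l2 /sqn star1 mul1r htau.2 sqrtr1. Qed.

Lemma l2_le_cnorm a : l2 a <= cnorm a.
Proof. by have := l2_mulr a 1; rewrite mulr1 l2_1 mulr1. Qed.

Lemma state_le_cnorm a : nc (tau a) <= cnorm a.
Proof.
have := cauchy_schwarz a 1; rewrite star1 mul1r l2_1 mulr1 => h.
exact: le_trans h (l2_le_cnorm a).
Qed.

Lemma sqn_orth_sum (n : nat) (f : nat -> A) :
  (forall i j, i <> j -> tau (star (f i) * f j) = 0) ->
  sqn (\sum_(i < n) f i) = \sum_(i < n) sqn (f i).
Proof.
move=> orth; elim: n => [|n ih].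
  by rewrite !big_ord0 /sqn star0 mul0r linear0.
rewrite !big_ord_recr /= sqnD ih.
suff -> : tau (star (f n) * \sum_(i < n) f i) = 0 by rewrite /= mulr0 addr0.
rewrite mulr_sumr raddf_sum big1 // => i _; apply: orth => e.
by have := ltn_ord i; rewrite -e ltnn.
Qed.

Hypothesis hfaithful : is_faithful tau.

Lemma l2_eq0 a : l2 a <= 0 -> a = 0.
Proof.
move=> h; apply: hfaithful; rewrite sqnE -l2_sq.
have -> : l2 a = 0 by apply/le_anti; rewrite h l2_ge0.
by rewrite expr0n.
Qed.

(* With [H = h^2 - K^2] and [b^2 = |H|], the vector [p = |H| + H] is a limit of
   elements of [V] and [<H p, p> = <b p, b p>], which forces [p = 0], that is
   [h^2 + b^2 = K^2]. *)
Lemma cnorm_le_of_l2_bound (h : A) (K : R) (V : A -> Prop) :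
  self_adjoint h -> 0 <= K ->
  V 1 -> (forall (c : R[i]) u v, V u -> V v -> V (c *: u + v)) ->
  (forall v, V v -> V (h * v)) ->
  (forall v, V v -> l2 (h * v) <= K * l2 v) ->
  cnorm h <= K.
Proof.
move=> hsa K0 V1 Vl Vh bnd.
(* [V] is only a subspace, while the root [b] is controlled through closed algebras. The left
   multipliers of [V] form a unital algebra that contains [h] and, since [V 1], is contained in
   [V]. *)
pose V0 w := forall v, V v -> V (w * v).
have V0V w : V0 w -> V w by move=> /(_ _ V1); rewrite mulr1.
have V0sub : @unital_subalgebra R A V0.
  split=> [v Vv|c u v hu hv w Vw|u v hu hv w Vw]; rewrite ?mul1r//.
    by rewrite mulrDl -scalerAl; apply: Vl; [exact: hu|exact: hv].
  by rewrite -mulrA; apply/hu/hv.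
pose W := adherent V0.
have cW : closed_subalgebra W := closure_subalgebra V0sub.
have [sW _] := cW; have [W1 _ Wm] := sW.
have Wh : W h by apply: adherent_of.
have bndW v : W v -> l2 (h * v) <= K * l2 v.
  move=> Wv; apply: le_eps => e e0.
  have k0 : 0 < cnorm h + K + 1 by rewrite ltr_wpDl// addr_ge0 ?cnorm_ge0.
  have [u /V0V Vu uv] := Wv _ (divr_gt0 e0 k0).
  have h1 : l2 (h * v) <= l2 (h * u) + cnorm h * l2 (v - u).
    rewrite -{1}(subrK u v) addrC mulrDr; apply: le_trans (l2D _ _) _.
    by rewrite lerD2l l2_mulr.
  have h2 : l2 u <= l2 v + l2 (v - u).
    by rewrite -(l2N (v - u)) opprB -{1}(subrK v u) addrC l2D.
  have h3 : l2 (v - u) <= e / (cnorm h + K + 1).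
    by apply: le_trans (l2_le_cnorm _) _; rewrite cnormB ltW.
  have h4 : (cnorm h + K) * l2 (v - u) <= e.
    apply: le_trans (_ : (cnorm h + K + 1) * (e / (cnorm h + K + 1)) <= _).
      by rewrite ler_pM ?addr_ge0 ?cnorm_ge0 ?l2_ge0// lerDl.
    by rewrite mulrC divfK// gt_eqF.
  have h5 := bnd _ Vu.
  have h6 : K * l2 u <= K * l2 v + K * l2 (v - u) by rewrite -mulrDr ler_wpM2l.
  lra.
pose H := h ^+ 2 - (K ^+ 2)%:C *: 1.
have Hsa : self_adjoint H.
  by rewrite /self_adjoint star_is_additive star_realZ star1 expr2 starM hsa.
have [b [bsa b4 bU]] := sqr_has_fourth_root Hsa.
have WH : W H.
  by apply: (subalg_B sW); [rewrite expr2; apply: Wm|apply: (subalg_Z _ sW)].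
have Hh : GRing.comm H h.
  by rewrite /GRing.comm mulrBl mulrBr -exprSr -exprS -scalerAl -scalerAr mulr1 mul1r.
have bH : GRing.comm b H by apply: comm_closed_of bU _.
have bh : GRing.comm b h by apply: comm_closed_of bU _.
pose p := b ^+ 2 + H.
have Wp : W p by apply: (subalg_D sW) => //; rewrite expr2; apply: Wm; exact: (bU W cW WH).
have psa : star p = p by rewrite starD Hsa expr2 starM bsa.
have Hp : H * p = b ^+ 2 * p.
  have HH : H * H = b ^+ 2 * b ^+ 2 by rewrite -expr2 -b4 -exprD.
  rewrite [LHS](mulrDr H) [RHS](mulrDr (b ^+ 2)) HH addrC; congr (_ + _).
  exact: (commrX 2 (esym bH : GRing.comm H b)).
have bp : GRing.comm b p.
  by rewrite /GRing.comm /p mulrDl mulrDr bH -exprS -exprSr.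
(* The bound on [W] makes the left side at most 0, while the right side is at least 0. *)
have E : sqn (h * p) - K ^+ 2 * sqn p = sqn (b * p).
  apply: complexI; rewrite rmorphB rmorphM /= -!sqnE !starM psa hsa bsa.
  rewrite -!mulrA (mulrA b) (mulrA h) -!expr2 -Hp /H mulrBl mulrBr stateB.
  by rewrite -scalerAl mul1r -scalerAr stateZ.
have bp0 : b * p = 0.
  apply: l2_eq0; rewrite -(@ler_pXn2r _ 2) ?nnegrE ?l2_ge0// l2_sq -E expr0n /=.
  have := bndW _ Wp => hp.
  rewrite -(@ler_pXn2r _ 2) ?nnegrE ?mulr_ge0 ?l2_ge0// exprMn !l2_sq in hp.
  by rewrite subr_le0.
(* [star p * p = (b ^+ 2 + H) * p], which is twice [b * (b * p)]. *)
have p0 : p = 0.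
  apply: hfaithful; rewrite psa {1}/p mulrDl Hp expr2 -mulrA bp0 mulr0 addr0.
  exact: linear0.
apply: (@cnorm_le_of_sum_squares _ _ K h b) => //.
have -> : b ^+ 2 = - H by apply/eqP; rewrite -addr_eq0 -/p p0.
by rewrite opprB addrC subrK.
Qed.

End States.
(** * Alternating words and the norm of free sums *)

Lemma sqr_sum_le (R : realFieldType) (n : nat) (a : nat -> R) :
  (\sum_(i < n) a i) ^+ 2 <= n%:R * \sum_(i < n) a i ^+ 2.
Proof.
elim: n => [|n ih]; first by rewrite !big_ord0 expr0n mul0r.
rewrite !big_ord_recr /=; set s := \sum_(i < n) a i in ih *.
set q := \sum_(i < n) a i ^+ 2 in ih *; rewrite -natr1.
have q0 : 0 <= q by apply: sumr_ge0 => i _; apply: sqr_ge0.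
have [n0|n0] := posnP n.
  have m0 : n%:R = 0 :> R by rewrite n0.
  rewrite m0 mul0r in ih; rewrite m0.
  have -> : s = 0 by apply/eqP; rewrite -sqrf_eq0 eq_le ih sqr_ge0.
  nra.
have m0 : 0 < n%:R :> R by rewrite ltr0n.
set m : R := n%:R in ih m0 *.
have : 0 <= (s - m * a n) ^+ 2 / m by rewrite divr_ge0 ?sqr_ge0 ?ltW.
have -> : (s - m * a n) ^+ 2 / m = s ^+ 2 / m - 2 * s * a n + m * a n ^+ 2.
  by field; rewrite gt_eqF.
have : s ^+ 2 / m <= q by rewrite ler_pdivrMr // mulrC.
nra.
Qed.

Section Freeness.
Variables (R : realType) (A : cstarAlgType R) (tau : {scalar A}).
Variable X : nat -> A -> Prop.
Hypothesis htau : is_state tau.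
Hypothesis X_subalg : forall i, @unital_subalgebra R A (X i).
Hypothesis X_star : forall i a, X i a -> X i (star a).
Hypothesis X_free : freely_independent tau X.
Implicit Types (s t : seq (nat * A)) (u v : A).

Definition first_index s : option nat := omap fst (ohead s).

(** The centred alternating words, on which freeness makes [tau] vanish; the empty word stands for 1
    and is the exception. Letters carry their index because an element may belong to several
    [X i]. *)
Fixpoint word s : Prop :=
  if s is p :: s' then
    [/\ X p.1 p.2, tau p.2 = 0, first_index s' <> Some p.1 & word s']
  else True.

Definition wprod s : A := \prod_(p <- s) p.2.

Lemma wprod_cons p s : wprod (p :: s) = p.2 * wprod s.
Proof. exact: big_cons. Qed.

Lemma wprod_cat s t : wprod (s ++ t) = wprod s * wprod t.
Proof. exact: big_cat. Qed.

Lemma word_nth s p0 j : word s -> (j < size s)%N ->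
  X (nth p0 s j).1 (nth p0 s j).2 /\ tau (nth p0 s j).2 = 0.
Proof.
elim: s j => [//|p s ih] [|j] /= [Xp tp _ ws] js; first by [].
exact: ih.
Qed.

Lemma word_adjacent s p0 j : word s -> (j.+1 < size s)%N ->
  (nth p0 s j).1 <> (nth p0 s j.+1).1.
Proof.
elim: s j => [//|p s ih] [|j] /= [_ _ hs ws] js; last exact: ih.
by case: s hs js {ih ws} => [//|q s] /= hs _ e; apply: hs; rewrite /first_index /= e.
Qed.

Lemma word_state0 s : word s -> s <> [::] -> tau (wprod s) = 0.
Proof.
case: s => // p s ws _; set w := p :: s in ws *.
rewrite /wprod (big_nth p) big_mkord.
apply: (X_free (i := fun j => (nth p w j).1) (a := fun j => (nth p w j).2)) => // j jm.
- exact: (word_nth p ws jm).1.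
- exact: (word_nth p ws jm).2.
- exact: word_adjacent.
Qed.

Definition star_word s := [seq (p.1, star p.2) | p <- rev s].

Lemma wprod_star s : star (wprod s) = wprod (star_word s).
Proof.
elim: s => [|p s ih]; first by rewrite /wprod !big_nil star1.
rewrite wprod_cons starM ih /star_word rev_cons map_rcons -cats1 wprod_cat.
by rewrite [wprod [:: _]]wprod_cons /wprod big_nil mulr1.
Qed.

Lemma state_star0 a : tau a = 0 -> tau (star a) = 0.
Proof. by move=> a0; rewrite state_star // a0 conjc0. Qed.

Lemma word_star_cat s t : word s -> word t ->
  s = [::] \/ first_index t <> first_index s -> word (star_word s ++ t).
Proof.
elim: s t => [//|p s ih] t /= [Xp tp hs ws] wt [//|ht].
rewrite /star_word rev_cons map_rcons cat_rcons; apply: ih => //.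
  by split => //; [exact: X_star|exact: state_star0].
by right => /esym.
Qed.

(** The last letter of [star_word t] is the adjoint of the first letter of [t]. If the first indices
    differ, [star_word t ++ s] is therefore again alternating, and it is not empty. *)
Lemma words_orthogonal s t : word s -> word t ->
  first_index s <> first_index t -> tau (star (wprod t) * wprod s) = 0.
Proof.
move=> ws wt hst; rewrite wprod_star -wprod_cat; apply: word_state0.
  by apply: word_star_cat => //; right.
case: t hst {wt} => [|p t] /=; first by case: s ws.
by move=> _; rewrite /star_word rev_cons map_rcons cat_rcons; case: (map _ _).
Qed.

(** The predicate [P] cuts out the subspaces of the free product decomposition, such as words
    beginning in [X i] or words avoiding [X i]. Induction on [span] extends statements from words by
    linearity. *)
Inductive span (P : seq (nat * A) -> Prop) : A -> Prop :=
| span0 : span P 0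
| span_add c s u of word s & P s & span P u : span P (c *: wprod s + u).

Lemma span_lin P (c : R[i]) u v : span P u -> span P v -> span P (c *: u + v).
Proof.
move=> hu hv; elim: hu => [|b s w ws Ps _ ih]; first by rewrite scaler0 add0r.
by rewrite scalerDr scalerA -addrA; apply: span_add.
Qed.

Lemma span_word (P : _ -> Prop) s : word s -> P s -> span P (wprod s).
Proof.
by move=> ws Ps; rewrite -[wprod s]scale1r -[_ *: _]addr0; apply/span_add/span0.
Qed.

Lemma spanZ P (c : R[i]) u : span P u -> span P (c *: u).
Proof. by move=> hu; rewrite -[_ *: _]addr0; apply/span_lin/span0. Qed.

Lemma spanD P u v : span P u -> span P v -> span P (u + v).
Proof. by move=> hu hv; rewrite -[u]scale1r; apply: span_lin. Qed.

Lemma span_sum P (I : Type) (r : seq I) (Q : pred I) (F : I -> A) :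
  (forall i, Q i -> span P (F i)) -> span P (\sum_(i <- r | Q i) F i).
Proof. by move=> h; elim/big_ind: _ => //; [exact: span0|exact: spanD]. Qed.

Lemma span_map (P Q : seq (nat * A) -> Prop) (f : A -> A) u :
  (forall c a b, f (c *: a + b) = c *: f a + f b) ->
  (forall s, word s -> P s -> span Q (f (wprod s))) -> span P u -> span Q (f u).
Proof.
move=> flin h; elim=> [|c s v ws Ps _ ih].
  have := flin (-1) 0 0; rewrite scaler0 addr0 scaleN1r addNr => ->.
  exact: span0.
by rewrite flin; apply: span_lin => //; apply: h.
Qed.

Lemma span_sub (P Q : seq (nat * A) -> Prop) u :
  (forall s, P s -> Q s) -> span P u -> span Q u.
Proof. by move=> PQ; apply: (@span_map _ _ id) => // s ws /PQ; apply: span_word. Qed.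

Lemma span_state0 (P : seq (nat * A) -> Prop) (f : A -> A) u :
  (forall c a b, f (c *: a + b) = c *: f a + f b) ->
  (forall s, word s -> P s -> tau (f (wprod s)) = 0) -> span P u -> tau (f u) = 0.
Proof.
move=> flin h; elim=> [|c s v ws Ps _ ih].
  have := flin (-1) 0 0; rewrite scaler0 addr0 scaleN1r addNr => ->.
  exact: linear0.
by rewrite flin stateD stateZ h // ih mulr0 addr0.
Qed.

Lemma span_orthogonal (P Q : seq (nat * A) -> Prop) u v :
  (forall s t, P s -> Q t -> first_index s <> first_index t) ->
  span P u -> span Q v -> tau (star v * u) = 0.
Proof.
move=> PQ hu hv.
apply: (@span_state0 P (fun a => star v * a)) hu => [c a b|s ws Ps].
  by rewrite mulrDr scalerAr.
apply: (can_inj (@conjcK _)); rewrite conjc0 -state_swap//.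
apply: (@span_state0 Q (fun a => star (wprod s) * a)) hv => [c a b|t wt Qt].
  by rewrite mulrDr scalerAr.
by apply: words_orthogonal => // e; apply: (PQ s t).
Qed.

Lemma centering i a : X i a -> X i (a - (tau a) *: 1) /\ tau (a - (tau a) *: 1) = 0.
Proof.
move=> Xa; split.
  by apply: (subalg_B (X_subalg i)) => //; apply: subalg_Z => //; case: (X_subalg i).
by rewrite stateB stateZ htau.2 mulr1 subrr.
Qed.

Definition letters (J : pred nat) s : Prop := all (fun p => J p.1) s.

Lemma mul_letter_fresh (J : pred nat) i a s : J i -> X i a -> word s -> letters J s ->
  first_index s <> Some i -> span (letters J) (a * wprod s).
Proof.
move=> Ji Xa ws Js hs; have [Xc tc] := centering Xa.
have -> : a * wprod s = wprod ((i, a - (tau a) *: 1) :: s) + (tau a) *: wprod s.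
  by rewrite wprod_cons /= mulrBl -scalerAl mul1r subrK.
apply: spanD; first by apply: span_word => //; rewrite /letters /= Ji.
by apply: spanZ; apply: span_word.
Qed.

(** If a word already begins in [X i], its first letter is merged into [a]; in either case the new
    first letter is split into its centred part and a scalar. *)
Lemma mul_letter (J : pred nat) i a u : J i -> X i a ->
  span (letters J) u -> span (letters J) (a * u).
Proof.
move=> Ji Xa; apply: (@span_map _ _ (fun v => a * v)) => [c b b'|s ws Js].
  by rewrite mulrDr scalerAr.
case: s ws Js => [|[j b] s] /=; first by move=> _ _; apply: (mul_letter_fresh Ji Xa).
move=> [/= Xb tb hs ws] /andP[/= Jj Js]; have [e|ne] := eqVneq j i.
  rewrite e in Xb hs; rewrite wprod_cons mulrA; apply: (mul_letter_fresh Ji) => //.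
  by case: (X_subalg i) => _ _; apply.
apply: (mul_letter_fresh Ji) => //; first by rewrite /letters /=; apply/andP.
by case=> /eqP; rewrite (negPf ne).
Qed.

(** Sorts the words of one representation of [u] by first index. [rest] collects the empty word and
    the words that begin with an index at least [n]. *)
Lemma span_decompose (P : seq (nat * A) -> Prop) (n : nat) u : span P u ->
  exists (f : nat -> A) (rest : A),
  [/\ u = rest + \sum_(i < n) f i,
      forall i, span (fun s => P s /\ first_index s = Some i) (f i) &
      span (fun s => P s /\ forall i, (i < n)%N -> first_index s <> Some i) rest].
Proof.
elim=> [|c s v ws Ps _ [f [rest [-> hf hrest]]]].
  exists (fun _ => 0), 0; split; [|by move=> i; exact: span0|exact: span0].
  by rewrite big1 // addr0.
case e : (first_index s) => [j|]; last first.
  exists f, (c *: wprod s + rest); split=> //; first by rewrite addrA.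
  by apply: span_add => //; split => // i _; rewrite e.
have [jn|nj] := ltnP j n; last first.
  exists f, (c *: wprod s + rest); split=> //; first by rewrite addrA.
  apply: span_add => //; split => // i i_n; rewrite e => -[ej].
  by move: nj; rewrite ej leqNgt i_n.
exists (fun i => (if i == j then c *: wprod s else 0) + f i), rest; split=> //.
  rewrite big_split /= addrCA; congr (_ + _); congr (_ + _).
  apply/esym; rewrite (bigD1 (Ordinal jn)) //= eqxx [X in _ + X]big1 ?addr0 // => i ij.
  by case: eqP => // eij; case/eqP: ij; apply: val_inj.
move=> i; apply: spanD => //; case: eqP => [->|_]; last exact: span0.
by apply: spanZ; apply: span_word.
Qed.

Hypothesis hfaithful : is_faithful tau.

(** * The norm of a sum of free centred variables *)

Section SumBound.
Variables (x : nat -> A) (M : R).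
Hypothesis x_mem : forall i, X i (x i).
Hypothesis x_centered : forall i, tau (x i) = 0.
Hypothesis x_bound : forall i, cnorm (x i) <= M.

(* [x i] maps words not beginning in [X i] to words beginning in [X i], so one of
   the four corners of [<x i u, v>] vanishes. *)
Lemma free_corner_bound i u v ui vi :
  span (fun s => True /\ first_index s = Some i) ui ->
  span (fun s => True /\ first_index s = Some i) vi ->
  span (fun s => first_index s <> Some i) (u - ui) ->
  span (fun s => first_index s <> Some i) (v - vi) ->
  nc (tau (star v * (x i * u))) <= M * (l2 tau v * l2 tau ui + l2 tau vi * l2 tau u).
Proof.
move=> hui hvi hu' hv'; set u' := u - ui in hu' *; set v' := v - vi in hv' *.
have M0 : 0 <= M by exact: le_trans (cnorm_ge0 _) (x_bound i).
have z0 : tau (star v' * (x i * u')) = 0.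
  apply: (@span_orthogonal (fun s => first_index s = Some i) (fun s => first_index s <> Some i)) => //.
    by move=> s t -> ht e; apply: ht.
  apply: (@span_map _ _ (fun w => x i * w)) hu' => [c a b|s ws hs].
    by rewrite mulrDr scalerAr.
  rewrite -(wprod_cons (i, x i)); apply: span_word => //=; split => //.
(* The corner of [u'] against [v'] is zero. The other three are grouped in two terms, each
   containing a component that begins in [X i]; this is what makes their sum over [i] small. *)
have -> : tau (star v * (x i * u)) =
    tau (star v * (x i * ui)) + tau (star vi * (x i * u')).
  rewrite -[u in LHS](subrK ui) -/u' addrC mulrDr mulrDr stateD; congr (_ + _).
  by rewrite -[v in LHS](subrK vi) -/v' starD mulrDl stateD z0 add0r.
(* [u = u' + ui] is an orthogonal decomposition. *)
have lu' : l2 tau u' <= l2 tau u.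
  rewrite -(@ler_pXn2r _ 2) ?nnegrE ?l2_ge0// -[u in leRHS](subrK ui) -/u'.
  rewrite (@l2_orthD _ _ _ htau u' ui) ?lerDl ?sqr_ge0//.
  apply: (@span_orthogonal (fun s => first_index s <> Some i) (fun s => True /\ first_index s = Some i)) => //.
  by move=> s t hs [_ ->].
apply: le_trans (le_normcD _ _) _; rewrite (mulrDr M); apply: lerD.
  apply: le_trans (cauchy_schwarz htau _ _) _.
  rewrite mulrC [leRHS]mulrCA ler_wpM2l ?l2_ge0//.
  by apply: le_trans (l2_mulr htau _ _) _; rewrite ler_wpM2r ?l2_ge0.
apply: le_trans (cauchy_schwarz htau _ _) _.
rewrite mulrC [leRHS]mulrCA ler_wpM2l ?l2_ge0//.
apply: le_trans (l2_mulr htau _ _) _.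
by rewrite ler_pM ?cnorm_ge0 ?l2_ge0.
Qed.

(** Cauchy-Schwarz over the [n] indices, then Pythagoras: the [f i] are orthogonal to each other and
    to [rest]. The factor [sqrt n] of the norm bound originates here. *)
Lemma sum_l2_le n (f : nat -> A) u rest :
  (forall i, span (fun s => True /\ first_index s = Some i) (f i)) ->
  span (fun s => True /\ forall i, (i < n)%N -> first_index s <> Some i) rest ->
  u = rest + \sum_(i < n) f i ->
  \sum_(i < n) l2 tau (f i) <= Num.sqrt n%:R * l2 tau u.
Proof.
move=> hf hrest ->.
have s0 : 0 <= \sum_(i < n) l2 tau (f i) by apply: sumr_ge0 => i _; exact: l2_ge0.
rewrite -(@ler_pXn2r _ 2) ?nnegrE ?mulr_ge0 ?sqrtr_ge0 ?l2_ge0//.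
apply: le_trans (sqr_sum_le n (fun i => l2 tau (f i))) _.
rewrite exprMn sqr_sqrtr ?ler0n// ler_wpM2l ?ler0n// l2_orthD//.
  rewrite ler_wpDl ?sqr_ge0// l2_sq// sqn_orth_sum//.
    by under eq_bigr do rewrite l2_sq //.
  move=> i j ij; apply: span_orthogonal (hf j) (hf i) => s t [_ ->] [_ ->] [e].
  exact: ij.
rewrite star_sum mulr_suml state_sum big1 // => i _.
apply: span_orthogonal hrest (hf i) => s t [_ hs] [_ ->].
exact: hs.
Qed.

Lemma free_sum_form_bound n u v : span (fun=> True) u -> span (fun=> True) v ->
  nc (tau (star v * ((\sum_(i < n) x i) * u))) <=
  2 * M * Num.sqrt n%:R * (l2 tau u * l2 tau v).
Proof.
move=> hu hv.
have [f [ru [eu hf hru]]] := span_decompose n hu.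
have [g [rv [ev hg hrv]]] := span_decompose n hv.
(* Removing the [i]-th component leaves no word that begins in [X i], as [free_corner_bound]
   demands. *)
have off (h : nat -> A) (r w : A) (i : 'I_n) :
    (forall j, span (fun s => True /\ first_index s = Some j) (h j)) ->
    span (fun s => True /\ forall j, (j < n)%N -> first_index s <> Some j) r ->
    w = r + \sum_(j < n) h j -> span (fun s => first_index s <> Some (i : nat)) (w - h i).
  move=> hh hr ->; rewrite (bigD1 i) //= addrCA addrAC subrr add0r.
  apply: spanD; first by apply: span_sub hr => s [_]; apply.
  apply: span_sum => j ji; apply: span_sub (hh j) => s [_ ->] [e].
  by case/eqP: ji; apply: val_inj.
rewrite mulr_suml mulr_sumr state_sum.
apply: le_trans (nc_sum _ _ _) _.
apply: le_trans (_ : \sum_(i < n) M * (l2 tau v * l2 tau (f i) + l2 tau (g i) * l2 tau u) <= _).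
  by apply: ler_sum => i _; apply: free_corner_bound => //; [exact: (off f ru)|exact: (off g rv)].
rewrite -mulr_sumr big_split /= -mulr_sumr -mulr_suml.
have M0 : 0 <= M by exact: le_trans (cnorm_ge0 _) (x_bound 0).
have h1 := sum_l2_le hf hru eu; have h2 := sum_l2_le hg hrv ev.
have h3 := ler_wpM2l (l2_ge0 tau v) h1; have h4 := ler_wpM2r (l2_ge0 tau u) h2.
have h5 := ler_wpM2l M0 (lerD h3 h4); apply: le_trans h5 _.
by rewrite le_eqVlt; apply/orP; left; apply/eqP; ring.
Qed.

Lemma free_sum_cnorm n : (forall i, self_adjoint (x i)) ->
  cnorm (\sum_(i < n) x i) <= 2 * M * Num.sqrt n%:R.
Proof.
move=> xsa; set h := \sum_(i < n) x i.
have M0 : 0 <= M by exact: le_trans (cnorm_ge0 _) (x_bound 0).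
have lettersT u : span (fun=> True) u <-> span (letters predT) u.
  by split; apply: span_sub => s _ //; rewrite /letters all_predT.
have Vh v : span (fun=> True) v -> span (fun=> True) (h * v).
  move=> hv; rewrite mulr_suml; apply: span_sum => i _; apply/lettersT.
  by apply: (@mul_letter _ i) => //; apply/lettersT.
apply: (@cnorm_le_of_l2_bound _ _ tau htau hfaithful _ _ (span (fun=> True))) => //.
- by rewrite /self_adjoint star_sum; apply: eq_bigr => i _; apply: xsa.
- by rewrite !mulr_ge0 ?sqrtr_ge0.
- by have := @span_word (fun=> True) [::] I I; rewrite /wprod big_nil.
- by move=> c u v; apply: span_lin.
(* Pair [h * v] with itself and divide by its L2 norm. *)
move=> v hv; have := free_sum_form_bound n hv (Vh _ hv); rewrite -/h.
rewrite sqnE// nc_real ger0_norm ?sqn_ge0// -l2_sq//.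
have := l2_ge0 tau (h * v); rewrite le_eqVlt => /orP[/eqP <- _|p0].
  by rewrite !mulr_ge0 ?sqrtr_ge0 ?l2_ge0.
by rewrite expr2 !mulrA ler_pM2r.
Qed.

End SumBound.

(** * Mixed moments of one algebra with words that avoid it *)

Section Factorization.
Variable i : nat.
Let away := letters (predC1 i).

Lemma away_first_index s : away s -> first_index s <> Some i.
Proof. by case: s => [|[j b] s] //= /andP[/= ji _] [e]; rewrite e eqxx in ji. Qed.

Lemma word_away_cat s a t : word s -> away s -> word ((i, a) :: t) ->
  word (s ++ (i, a) :: t).
Proof.
move=> + + wt; elim: s => [//|[j b] s ih] /= [Xb tb hs ws] /andP[/= ji As].
split => //; last exact: ih.
by case: s hs {ih ws As} => [|q s] //= _ [e]; rewrite e eqxx in ji.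
Qed.

(** Nonempty words have state 0, so subtracting the state removes exactly the empty-word
    component. *)
Lemma span_away_center u : span away u ->
  span (fun s => away s /\ s <> [::]) (u - (tau u) *: 1).
Proof.
move=> hu.
apply: (@span_map _ _ (fun w => w - (tau w) *: 1)) hu => [c a b|s ws As].
  by rewrite stateD stateZ scalerDl opprD addrACA scalerBr scalerA.
case: s ws As => [|p s] ws As.
  by rewrite /wprod big_nil htau.2 scale1r subrr; exact: span0.
by rewrite word_state0 // scale0r subr0; apply: span_word.
Qed.

Lemma state_centered_away a u : X i a -> tau a = 0 -> span away u -> tau (a * u) = 0.
Proof.
move=> Xa ta; apply: (@span_state0 _ (fun w => a * w)) => [c b b'|s ws As].
  by rewrite mulrDr scalerAr.
rewrite -[a]/((i, a).2) -wprod_cons; apply: word_state0 => //=; split => //.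
exact: away_first_index.
Qed.

Lemma state_mul_away a u : X i a -> span away u -> tau (a * u) = tau a * tau u.
Proof.
move=> Xa hu; have [Xc tc] := centering Xa.
have := state_centered_away Xc tc hu.
by rewrite mulrBl -scalerAl mul1r stateB stateZ => /eqP; rewrite subr_eq0 => /eqP.
Qed.

(** Once [u] is centred, [a u b v] is a combination of alternating words and has state 0; the words
    of [v] may be empty, as they come last. What remains is [tau u] times the state of [(a b) v],
    which factors. *)
Lemma state_alternating4 a u b v : X i a -> X i b -> tau a = 0 -> tau b = 0 ->
  span away u -> span away v ->
  tau (a * (u * (b * v))) = tau (a * b) * tau u * tau v.
Proof.
move=> Xa Xb ta tb hu hv.
suff z : tau (a * ((u - (tau u) *: 1) * (b * v))) = 0.
  move: z; rewrite mulrBl mulrBr stateB -scalerAl mul1r -scalerAr stateZ => /eqP.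
  rewrite subr_eq0 => /eqP ->; rewrite (mulrA a) (@state_mul_away (a * b) v) //.
    by rewrite mulrCA mulrA.
  by case: (X_subalg i) => _ _; apply.
apply: (@span_state0 _ (fun w => a * (w * (b * v)))) (span_away_center hu).
  by move=> c w w'; rewrite mulrDl mulrDr -scalerAl -scalerAr.
move=> s ws [As sn].
apply: (@span_state0 _ (fun w => a * (wprod s * (b * w)))) hv.
  by move=> c w w'; rewrite !mulrDr -!scalerAr.
move=> t wt At.
have wbt : word ((i, b) :: t) by split => //; apply: away_first_index.
have := word_away_cat ws As wbt.
rewrite -[a]/((i, a).2) -[b]/((i, b).2) -wprod_cons -wprod_cat -wprod_cons => w2.
apply: word_state0 => //=; split => //.
by case: s {ws} As sn w2 => // [[j c] s] As _ _; exact: (away_first_index As).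
Qed.

End Factorization.

End Freeness.
(** * The Schwinger-Dyson equation *)

Section GeneratedAlgebra.
Variables (R : realType) (A : cstarAlgType R).
Implicit Types (S : set A).

Lemma gen_alg_subalgebra S : @unital_subalgebra R A (gen_alg S).
Proof.
split=> [U [[U1 _ _] _] //|c u v hu hv U [[U1 Ul Um] SU]|u v hu hv U [[U1 Ul Um] SU]].
  have hU := conj (And3 U1 Ul Um) SU; exact: (Ul c u v (hu U hU) (hv U hU)).
have hU := conj (And3 U1 Ul Um) SU; exact: (Um u v (hu U hU) (hv U hU)).
Qed.

Lemma gen_alg_incl S a : S a -> gen_alg S a.
Proof. by move=> Sa U [_ SU]; apply: SU. Qed.

Lemma gen_alg_star S : (forall a, S a -> self_adjoint a) ->
  forall a, gen_alg S a -> gen_alg S (star a).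
Proof.
move=> Ssa a ha; apply: (ha (fun u => gen_alg S (star u))); split; last first.
  by move=> u Su; rewrite Ssa //; apply: gen_alg_incl.
have [g1 gl gm] := gen_alg_subalgebra S.
split=> [|c u v hu hv|u v hu hv]; first by rewrite star1.
  by rewrite starD starZ; apply: gl.
by rewrite starM; apply: gm.
Qed.

End GeneratedAlgebra.

(** Meant for [Q] the factors cleared of [x i]: in each term the part before the exchanged letter is
    already cleared, and only the part after it still has to be. *)
Lemma prod_nat_telescope (A : nzRingType) (P Q : nat -> A) (a b : nat) : (a <= b)%N ->
  \prod_(a <= j < b) P j - \prod_(a <= j < b) Q j =
  \sum_(a <= c < b) (\prod_(a <= j < c) Q j) * ((P c - Q c) * \prod_(c.+1 <= j < b) P j).
Proof.
move=> ab; have [m e] := ubnP (b - a)%N; elim: m a ab e => // m ih a ab e.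
have [ba|lt] := leqP b a; first by rewrite !big_geq // subrr.
rewrite [in LHS](big_ltn lt) [X in _ - X](big_ltn lt) [RHS](big_ltn lt).
rewrite [\prod_(a <= j < a) _]big_geq // mul1r.
have -> : \sum_(a.+1 <= c < b) (\prod_(a <= j < c) Q j) * ((P c - Q c) * \prod_(c.+1 <= j < b) P j)
  = Q a * \sum_(a.+1 <= c < b) (\prod_(a.+1 <= j < c) Q j) * ((P c - Q c) * \prod_(c.+1 <= j < b) P j).
  rewrite mulr_sumr !big_nat; apply: eq_bigr => c /andP[ac _].
  by rewrite (big_ltn ac) -!mulrA.
by rewrite -ih ?mulrBl ?mulrBr ?addrA ?subrK //; lia.
Qed.

Lemma clt_sum_self_adjoint (R : realType) (A : cstarAlgType R) (d : nat)
    (x : nat -> 'I_d -> A) n k :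
  (forall i l, self_adjoint (x i l)) -> self_adjoint (clt_sum x n k).
Proof.
move=> xsa; rewrite /self_adjoint /clt_sum star_realZ star_sum.
by congr (_ *: _); apply: eq_bigr => i _; apply: xsa.
Qed.

Lemma interval_split (a b c : nat) : (a < c)%N -> (c < b)%N ->
  (b - a = ((c - a.+1) + (b - c.+1)).+2)%N.
Proof. lia. Qed.

Section SchwingerDyson.
Variables (R : realType) (A : cstarAlgType R) (tau : {scalar A}).
Hypotheses (htau : is_state tau) (hfaithful : is_faithful tau).
Variables (d : nat) (x : nat -> 'I_d -> A).
Hypothesis hfree : free_sets tau x.
Hypothesis hsa : forall i k, self_adjoint (x i k).
Hypothesis hcentered : forall i k, tau (x i k) = 0.
Variable M : R.
Hypothesis M_ge1 : 1 <= M.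
Hypothesis hbound : forall i k, cnorm (x i k) <= M.
Variable Sigma : 'M[R[i]]_d.
Hypothesis hSigma : forall i k l, Sigma k l = tau (x i k * x i l).

Let X (i : nat) : A -> Prop := gen_alg (range (x i)).

Let X_subalg i : @unital_subalgebra R A (X i).
Proof. exact: gen_alg_subalgebra. Qed.

Let X_star i a : X i a -> X i (star a).
Proof. by apply: gen_alg_star => _ [k _ <-]; apply: hsa. Qed.

Let X_mem i k : X i (x i k).
Proof. by apply: gen_alg_incl; exists k. Qed.

Let M_ge0 : 0 <= M := le_trans ler01 M_ge1.

Lemma nc_Sigma k l : nc (Sigma k l) <= M ^+ 2.
Proof.
rewrite (hSigma 0%N); apply: le_trans (state_le_cnorm htau _) _.
by apply: le_trans (cnormM _ _) _; rewrite expr2 ler_pM ?cnorm_ge0.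
Qed.

Section FixedSize.
Variable n : nat.
Hypothesis n_gt0 : (0 < n)%N.
Let eps : R := (Num.sqrt n%:R)^-1.
(** [2 * M] for the full sum plus at most [M] for deleting one summand, since [eps <= 1]. *)
Let K : R := 3 * M.

Let sqrt_gt0 : 0 < Num.sqrt (n%:R : R).
Proof. by rewrite sqrtr_gt0 ltr0n. Qed.

Let eps_ge0 : 0 <= eps.
Proof. by rewrite invr_ge0 ltW. Qed.

Let eps_le1 : eps <= 1.
Proof. by rewrite invf_le1 // -[leLHS]sqrtr1 ler_wsqrtr // ler1n. Qed.

Let eps_sqr : eps * eps * n%:R = 1.
Proof.
have e : Num.sqrt (n%:R : R) ^+ 2 = n%:R by rewrite sqr_sqrtr ?ler0n.
by rewrite -[X in _ * X]e /eps; field; rewrite gt_eqF.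
Qed.

Lemma clt_sum_cnorm k : cnorm (clt_sum x n k) <= 2 * M.
Proof.
rewrite /clt_sum cnorm_realZ // mulrC ler_pdivrMr //.
by apply: (@free_sum_cnorm _ _ _ X htau X_subalg X_star hfree hfaithful (x^~ k)).
Qed.

Let away_sum i k : A := clt_sum x n k - eps%:C *: x i k.

Let clt_sum_cnormK k : cnorm (clt_sum x n k) <= K.
Proof. by apply: le_trans (clt_sum_cnorm k) _; rewrite ler_wpM2r // ler_nat. Qed.

Let away_sum_cnorm i k : cnorm (away_sum i k) <= K.
Proof.
apply: le_trans (cnormD _ _) _; rewrite cnormN cnorm_realZ // /K.
have := clt_sum_cnorm k.
have : eps * cnorm (x i k) <= 1 * M by rewrite ler_pM ?cnorm_ge0.
lra.
Qed.

Variable k : nat -> 'I_d.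
Let W a b : A := \prod_(a <= j < b) clt_sum x n (k j).
Let W' i a b : A := \prod_(a <= j < b) away_sum i (k j).

Let K_ge0 : 0 <= K. Proof. by rewrite mulr_ge0. Qed.
Let M_leK : M <= K. Proof. by rewrite /K ler_peMl // ler1n. Qed.

Lemma clt_word_cnorm a b : cnorm (W a b) <= (3 * M) ^+ (b - a).
Proof.
rewrite /W -[X in _ ^+ X](size_iota a (b - a)).
by apply: (cnorm_prod _ (F := fun j => clt_sum x n (k j))).
Qed.

Let W'_cnorm i a b : cnorm (W' i a b) <= K ^+ (b - a).
Proof.
rewrite /W' -[X in _ ^+ X](size_iota a (b - a)).
by apply: (cnorm_prod _ (F := fun j => away_sum i (k j))).
Qed.

Let W_telescope i a b : (a <= b)%N ->
  W a b - W' i a b = \sum_(a <= c < b) eps%:C *: (W' i a c * (x i (k c) * W c.+1 b)).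
Proof.
move=> ab; rewrite prod_nat_telescope //; apply: eq_bigr => c _.
by rewrite /away_sum opprB addrCA subrr addr0 -scalerAl -scalerAr.
Qed.

Let W_diff i a b : (a <= b)%N ->
  cnorm (W a b - W' i a b) <= eps * ((b - a)%:R * K ^+ (b - a)).
Proof.
move=> ab; rewrite W_telescope //; apply: le_trans (cnorm_sum _ _ _) _.
apply: le_trans (_ : \sum_(a <= c < b) eps * K ^+ (b - a) <= _); last first.
  by rewrite sumr_const_nat -[leLHS]mulr_natl mulrCA.
rewrite !big_nat; apply: ler_sum => c /andP[ac cb].
rewrite cnorm_realZ // ler_wpM2l //.
have -> : (b - a = (c - a) + (b - c.+1).+1)%N by lia.
rewrite exprD exprS; apply: le_trans (cnormM _ _) _.
rewrite ler_pM ?cnorm_ge0 //; apply: le_trans (cnormM _ _) _.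
by rewrite ler_pM ?cnorm_ge0 ?clt_word_cnorm // (le_trans (hbound _ _)).
Qed.

(** For [i < n] the subtracted term is one of the summands, so only variables of other indices
    remain. *)
Let away_span i a b : (i < n)%N -> span tau X (letters (predC1 i)) (W' i a b).
Proof.
move=> i_n.
rewrite /W'; elim: (index_iota a b) => [|j s ih].
  by have := @span_word _ _ tau X (letters (predC1 i)) [::] I isT; rewrite /wprod !big_nil.
rewrite big_cons; set u := \prod_(_ <- s) _ in ih *.
have -> : away_sum i (k j) = eps%:C *: \sum_(l < n | l != i :> nat) x l (k j).
  rewrite /away_sum /clt_sum -scalerBr (bigD1 (Ordinal i_n)) //=; congr (_ *: _).
  by rewrite addrAC subrr add0r.
rewrite -scalerAl; apply: spanZ; rewrite mulr_suml; apply: span_sum => l li.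
by apply: (mul_letter htau X_subalg (i := l)).
Qed.

Let main a b c : R[i] := Sigma (k a) (k c) * tau (W a.+1 c) * tau (W c.+1 b).

Let nc_state_W a b : nc (tau (W a b)) <= K ^+ (b - a).
Proof. exact: le_trans (state_le_cnorm htau _) (clt_word_cnorm _ _). Qed.

Let nc_state_W' i a b : nc (tau (W' i a b)) <= K ^+ (b - a).
Proof. exact: le_trans (state_le_cnorm htau _) (W'_cnorm _ _ _). Qed.

(** Clearing the last [W] of [x i] costs [h1]; the state is then given exactly by
    [state_alternating4]; putting [W] back into both moments costs [h2]. The length [q] is counted
    twice, and [p + 2 q] is at most [2 r]. *)
Let letter_error i a b c : (i < n)%N -> (a < c)%N -> (c < b)%N ->
  nc (tau (x i (k a) * (W' i a.+1 c * (x i (k c) * W c.+1 b))) - main a b c)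
    <= 2 * eps * ((b - a)%:R * K ^+ (b - a)).
Proof.
move=> i_n ac cb.
set r := (b - a)%N; set p := (c - a.+1)%N; set q := (b - c.+1)%N.
have er : r = (p + q).+2 by exact: interval_split.
have Kp : 0 <= K ^+ p by exact: exprn_ge0.
have Kq : 0 <= K ^+ q by exact: exprn_ge0.
have KrE : K ^+ r = K * K * (K ^+ p * K ^+ q) by rewrite er !exprS exprD mulrA.
have pr : p%:R + q%:R <= r%:R :> R by rewrite -natrD ler_nat er (leq_trans (leqnSn _)).
have MK : M * M <= K * K by rewrite ler_pM.
pose mid := tau (x i (k a) * (W' i a.+1 c * (x i (k c) * W' i c.+1 b))).
have midE : mid = Sigma (k a) (k c) * tau (W' i a.+1 c) * tau (W' i c.+1 b).
  rewrite /mid (hSigma i).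
  by apply: (state_alternating4 htau X_subalg hfree (i := i)) => //; exact: away_span.
have h1 : nc (tau (x i (k a) * (W' i a.+1 c * (x i (k c) * W c.+1 b))) - mid)
    <= eps * (q%:R * K ^+ r).
  rewrite /mid -stateB -!mulrBr; apply: le_trans (state_le_cnorm htau _) _.
  apply: le_trans (_ : M * (K ^+ p * (M * (eps * (q%:R * K ^+ q)))) <= _).
    do 3![apply: le_trans (cnormM _ _) _; rewrite ler_pM ?cnorm_ge0 //].
    exact: W_diff.
  have -> : M * (K ^+ p * (M * (eps * (q%:R * K ^+ q)))) =
    eps * (q%:R * (M * M * (K ^+ p * K ^+ q))) by ring.
  rewrite KrE !ler_wpM2l ?ler0n //.
  by rewrite ler_wpM2r ?mulr_ge0.
have h2 : nc (mid - main a b c) <= eps * ((p%:R + q%:R) * K ^+ r).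
  rewrite midE /main -!mulrA -mulrBr Normc.normcM.
  set s := tau (W' i a.+1 c); set t := tau (W' i c.+1 b).
  set s' := tau (W a.+1 c); set t' := tau (W c.+1 b).
  have -> : s * t - s' * t' = (s - s') * t + s' * (t - t') by ring.
  have hs : nc (s - s') <= eps * (p%:R * K ^+ p).
    by rewrite nc_B /s /s' -stateB; apply: le_trans (state_le_cnorm htau _) (W_diff _ _).
  have ht : nc (t - t') <= eps * (q%:R * K ^+ q).
    by rewrite nc_B /t /t' -stateB; apply: le_trans (state_le_cnorm htau _) (W_diff _ _).
  have h3 : nc ((s - s') * t + s' * (t - t')) <= eps * ((p%:R + q%:R) * (K ^+ p * K ^+ q)).
    apply: le_trans (le_normcD _ _) _; rewrite !Normc.normcM.
    have -> : eps * ((p%:R + q%:R) * (K ^+ p * K ^+ q)) =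
      eps * (p%:R * K ^+ p) * K ^+ q + K ^+ p * (eps * (q%:R * K ^+ q)) by ring.
    by apply: lerD; apply: ler_pM; rewrite ?nc_ge0 ?nc_state_W ?nc_state_W'.
  have h4 := nc_Sigma (k a) (k c).
  apply: le_trans (ler_pM (nc_ge0 _) (nc_ge0 _) h4 h3) _.
  have -> : M ^+ 2 * (eps * ((p%:R + q%:R) * (K ^+ p * K ^+ q))) =
     eps * ((p%:R + q%:R) * (M * M * (K ^+ p * K ^+ q))) by ring.
  rewrite KrE !ler_wpM2l ?addr_ge0 ?ler0n //.
  by rewrite ler_wpM2r ?mulr_ge0.
have -> : tau (x i (k a) * (W' i a.+1 c * (x i (k c) * W c.+1 b))) - main a b c =
  (tau (x i (k a) * (W' i a.+1 c * (x i (k c) * W c.+1 b))) - mid) + (mid - main a b c).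
  by rewrite addrA subrK.
apply: le_trans (le_normcD _ _) _; apply: le_trans (lerD h1 h2) _.
rewrite -mulrDr -mulrDl -mulrA (mulrCA 2) ler_wpM2l // mulrA ler_wpM2r ?exprn_ge0 //.
have : 0 <= p%:R :> R by exact: ler0n.
lra.
Qed.

(* Only the first order in [eps] of the dependence of [W] on [x i] contributes. *)
Lemma schwinger_dyson a b : (a < b)%N ->
  nc (tau (W a b) - \sum_(a.+1 <= c < b) main a b c) <=
  (Num.sqrt n%:R)^-1 * (2 * ((b - a)%:R ^+ 2 * (3 * M) ^+ (b - a))).
Proof.
move=> ab; rewrite -/K -/eps; set r := (b - a)%N.
pose err i c := tau (x i (k a) * (W' i a.+1 c * (x i (k c) * W c.+1 b))) - main a b c.
(* The zeroth order vanishes because [x i] is centred and free from [W'], so only the telescoping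
   sum is left. *)
have letter i : (i < n)%N -> tau (x i (k a) * W a.+1 b) =
    eps%:C * \sum_(a.+1 <= c < b) (err i c + main a b c).
  move=> i_n; rewrite -[W _ _](subrK (W' i a.+1 b)) mulrDr stateD.
  have -> : tau (x i (k a) * W' i a.+1 b) = 0.
    by apply: (@state_centered_away _ _ tau X hfree i) => //; exact: away_span.
  rewrite addr0.
  rewrite W_telescope // -scaler_sumr -scalerAr stateZ mulr_sumr state_sum.
  by congr (_ * _); apply: eq_bigr => c _; rewrite /err subrK.
(* The [n] main contributions, each with coefficient [eps ^ 2], add up to exactly one. *)
have e2 : (eps * eps * n%:R)%:C = 1 by rewrite eps_sqr.
have -> : tau (W a b) - \sum_(a.+1 <= c < b) main a b c =
    eps%:C * \sum_(i < n) eps%:C * \sum_(a.+1 <= c < b) err i c.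
  have -> : tau (W a b) = eps%:C * \sum_(i < n) eps%:C * \sum_(a.+1 <= c < b) (err i c + main a b c).
    rewrite /W (big_ltn ab) {1}/clt_sum -scalerAl stateZ mulr_suml state_sum.
    by congr (_ * _); apply: eq_bigr => i _; apply: letter.
  under eq_bigr do rewrite big_split mulrDr /=.
  rewrite big_split /= mulrDr sumr_const card_ord.
  set B := \sum_(a.+1 <= c < b) main a b c.
  have -> : eps%:C * ((eps%:C * B) *+ n) = B.
    rewrite -mulr_natl !mulrA [eps%:C * _]mulrC -!mulrA mulrA.
    have -> : n%:R * eps%:C * (eps%:C * B) = (eps * eps * n%:R)%:C * B.
      by rewrite !realCM (rmorph_nat (real_complex R)); ring.
    by rewrite e2 mul1r.
  by rewrite addrK.
rewrite Normc.normcM nc_real ger0_norm // ler_wpM2l //.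
apply: le_trans (nc_sum _ _ _) _.
(* There are [n] letters and at most [r] positions, each with error [2 * eps * (r * K ^ r)]; here
   [n * eps ^ 2 = 1] again, and the outer [eps] gives the rate. *)
apply: le_trans (_ : \sum_(i < n) eps * (r%:R * (2 * eps * (r%:R * K ^+ r))) <= _).
  apply: ler_sum => i _; rewrite Normc.normcM nc_real ger0_norm // ler_wpM2l //.
  apply: le_trans (nc_sum _ _ _) _.
  apply: le_trans (_ : \sum_(a.+1 <= c < b) 2 * eps * (r%:R * K ^+ r) <= _).
    rewrite !big_nat; apply: ler_sum => c /andP[ac cb].
    exact: letter_error.
  rewrite sumr_const_nat -[leLHS]mulr_natl ler_wpM2r ?ler_nat ?mulr_ge0 ?exprn_ge0 //.
  by rewrite /r; lia.
rewrite sumr_const card_ord -[leLHS]mulr_natl.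
have -> : n%:R * (eps * (r%:R * (2 * eps * (r%:R * K ^+ r)))) =
  (eps * eps * n%:R) * (2 * (r%:R ^+ 2 * K ^+ r)) by ring.
by rewrite eps_sqr mul1r.
Qed.

End FixedSize.

End SchwingerDyson.
(** * Non-crossing pairings *)

Section NonCrossingPairings.
Local Open Scope set_scope.
Variables (R : comNzRingType) (N : nat) (w : 'I_N -> 'I_N -> R).
Implicit Types (S B : {set 'I_N}) (P Q : {set {set 'I_N}}).

(** Pairings of a subset of a fixed ['I_N], so that the recursion over subintervals stays within one
    type; on the full set this is convertible to [is_pairing]. *)
Definition pairing S P : bool :=
  finset.partition P S && [forall B in P, #|B| == 2%N].

Definition pairing_weight P : R :=
  \prod_(ab : 'I_N * 'I_N | (ab.1 < ab.2)%N && ([set ab.1; ab.2] \in P))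
    w ab.1 ab.2.

Definition noncrossing_sum S : R :=
  \sum_(P | pairing S P && is_noncrossing P) pairing_weight P.

Lemma pairingP S P : reflect
  [/\ forall B, B \in P -> #|B| = 2%N, forall B, B \in P -> B \subset S,
      forall i, i \in S -> exists2 B, B \in P & i \in B &
      forall B C i, B \in P -> C \in P -> i \in B -> i \in C -> B = C]
  (pairing S P).
Proof.
apply: (iffP andP) => [[/and3P[/eqP cov /finset.trivIsetP triv _] /'forall_implyP two]|[two sub cov eqv]].
  split=> [B PB|B PB|i Si|B C i PB PC iB iC].
  - exact/eqP/two.
  - by rewrite -cov; apply: finset.bigcup_sup.
  - by move: Si; rewrite -cov => /finset.bigcupP[B PB iB]; exists B.
  - apply/eqP; apply: contraT => nBC; have := triv _ _ PB PC nBC.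
    by rewrite finset.disjoints_subset => /fintype.subsetP/(_ i iB); rewrite finset.inE iC.
split; last by apply/'forall_implyP => B /two ->.
apply/and3P; split.
- apply/eqP/finset.setP => i; apply/finset.bigcupP/idP => [[B PB iB]|/cov[B PB iB]].
    by apply: (fintype.subsetP (sub _ PB)).
  by exists B.
- apply/finset.trivIsetP => B C PB PC; apply: contraNT.
  rewrite -setI_eq0 => /finset.set0Pn[i iBC]; move: iBC; rewrite finset.inE => /andP[iB iC].
  exact/eqP/(eqv _ _ i).
- by apply/negP => /two; rewrite finset.cards0.
Qed.

Lemma pair_set_ordered B : #|B| = 2%N -> exists i j : 'I_N, (i < j)%N /\ B = [set i; j].
Proof.
move/eqP/finset.cards2P => [i [j [ij ->]]].
case: (ltngtP i j) ij => [lt _|gt _|e]; first by exists i, j.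
  by exists j, i; split=> //; rewrite finset.setUC.
by move=> /eqP[]; apply: val_inj.
Qed.

Lemma pair_set_inj (a b i j : 'I_N) : (a < b)%N -> (i < j)%N ->
  [set a; b] = [set i; j] -> a = i /\ b = j.
Proof.
move=> ab ij e.
have := finset.set21 a b; have := finset.set22 a b; rewrite e !finset.inE.
move=> /orP[/eqP eb|/eqP eb] /orP[/eqP ea|/eqP ea] //.
- by move: ab; rewrite ea eb ltnn.
- by move: ab ij; rewrite ea eb => h1 h2; have := ltn_trans h1 h2; rewrite ltnn.
- by move: ab; rewrite ea eb ltnn.
Qed.

Lemma noncrossingP P : reflect
  (forall a b c e : 'I_N, (a < b)%N -> (b < c)%N -> (c < e)%N ->
     [set a; c] \in P -> [set b; e] \in P -> False) (is_noncrossing P).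
Proof.
apply: (iffP idP) => [/negP nc a b c e ab bc ce ac be|h].
  apply: nc; apply/existsP; exists a; apply/existsP; exists b.
  apply/existsP; exists c; apply/existsP; exists e.
  by rewrite ab bc ce ac be.
apply/negP => /existsP[a /existsP[b /existsP[c /existsP[e /and5P[ab bc ce ac be]]]]].
exact: (h a b c e).
Qed.

(** On a two-point block this product has a single factor, the weight of its increasing listing; the
    product form spares a choice of endpoints. *)
Definition block_weight B : R :=
  \prod_(ab : 'I_N * 'I_N | (ab.1 < ab.2)%N && ([set ab.1; ab.2] == B)) w ab.1 ab.2.

(** In this form the weight is visibly multiplicative over disjoint unions of pairings. *)
Lemma pairing_weightE P : pairing_weight P = \prod_(B in P) block_weight B.
Proof.
rewrite /pairing_weight.
rewrite (partition_big (fun ab : 'I_N * 'I_N => [set ab.1; ab.2]) (mem P)) /=.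
  apply: eq_bigr => B PB; apply: eq_bigl => -[i j] /=.
  by case: eqP => [->|]; rewrite ?PB ?andbT ?andbF.
by move=> ab /andP[].
Qed.

Lemma block_weight_pair (a c : 'I_N) : (a < c)%N -> block_weight [set a; c] = w a c.
Proof.
move=> ac; rewrite /block_weight (big_pred1 (a, c)) // => -[i j] /=.
apply/andP/eqP => [[ij /eqP e]|[-> ->]]; last by rewrite eqxx.
by have [-> ->] := pair_set_inj ij ac e.
Qed.

Definition interval (a b : nat) : {set 'I_N} := [set j : 'I_N | (a <= j < b)%N].

Lemma in_interval a b (j : 'I_N) : (j \in interval a b) = (a <= j < b)%N.
Proof. by rewrite finset.inE. Qed.

Lemma noncrossing_sum_nil a : noncrossing_sum (interval a a) = 1.
Proof.
rewrite /noncrossing_sum (big_pred1 finset.set0) => [|P].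
  by rewrite pairing_weightE big_pred0 // => B; rewrite finset.inE.
apply/andP/eqP => [[/pairingP[two sub _ _] _]|->].
  apply/finset.setP => B; rewrite finset.inE; apply/negP => PB.
  have [i [j [_ eB]]] := pair_set_ordered (two _ PB).
  have : i \in interval a a by apply: (fintype.subsetP (sub _ PB)); rewrite eB finset.set21.
  by rewrite in_interval; case/andP => h1; rewrite ltnNge h1.
split; last by apply/noncrossingP => i j l m _ _ _; rewrite finset.inE.
apply/pairingP; split=> [B|B|i|B C i]; rewrite ?finset.inE //.
by case/andP => h1; rewrite ltnNge h1.
Qed.

Section Split.
Variables (a b : nat) (a' c : 'I_N).
Hypotheses (ea : a' = a :> nat) (ac : (a < c)%N) (cb : (c < b)%N).
Let I1 := interval a.+1 c.
Let I2 := interval c.+1 b.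
Let top : {set 'I_N} := [set a'; c].

Let I1P (i : 'I_N) : i \in I1 = (a < i < c)%N.
Proof. exact: in_interval. Qed.

Let I2P (i : 'I_N) : i \in I2 = (c < i < b)%N.
Proof. exact: in_interval. Qed.

Definition below P S : {set {set 'I_N}} := [set B in P | B \subset S].

Let a'c : (a' < c)%N. Proof. by rewrite ea. Qed.

(** A block with one point strictly between [a] and [c] and the other beyond [c] would cross
    [top]. *)
Lemma block_below P B : pairing (interval a b) P -> is_noncrossing P -> top \in P ->
  B \in P -> B = top \/ B \subset I1 \/ B \subset I2.
Proof.
move=> /pairingP[two sub _ eqv] /noncrossingP ncr topP PB.
have [->|/eqP nB] := eqVneq B top; [by left|right].
have [i [j [ij eB]]] := pair_set_ordered (two _ PB).
have loc l : l \in B -> l \in I1 \/ l \in I2.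
  move=> lB; have := fintype.subsetP (sub _ PB) _ lB; rewrite in_interval => /andP[al lb].
  have la : l != a' :> nat.
    apply/eqP => /val_inj e; apply: nB; apply: (eqv _ _ l) => //.
    by rewrite e finset.set21.
  have lc : l != c :> nat.
    apply/eqP => /val_inj e; apply: nB; apply: (eqv _ _ l) => //.
    by rewrite e finset.set22.
  rewrite I1P I2P; move: la lc; rewrite ea => la lc.
  by case: (ltngtP l c) lc => // h _; [left|right]; rewrite ?h ?lb ?andbT // ltn_neqAle eq_sym la.
have iB : i \in B by rewrite eB finset.set21.
have jB : j \in B by rewrite eB finset.set22.
case: (loc _ iB) => hi; case: (loc _ jB) => hj.
- by left; rewrite eB; apply/fintype.subsetP => l; rewrite !finset.inE => /orP[] /eqP -> ; rewrite -?I1P -?in_interval.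
- move: hi hj; rewrite I1P I2P => /andP[ai ic] /andP[cj _].
  by case: (ncr a' i c j) => //; rewrite ?ea // -eB.
- move: hi hj; rewrite I1P I2P => /andP[ci _] /andP[_ jc].
  by have := ltn_trans (ltn_trans ci ij) jc; rewrite ltnn.
- by right; rewrite eB; apply/fintype.subsetP => l; rewrite !finset.inE => /orP[] /eqP -> ; rewrite -?I2P -?in_interval.
Qed.

Lemma block_not_both B : #|B| = 2%N -> B \subset I1 -> B \subset I2 -> False.
Proof.
move=> /pair_set_ordered[i [j [_ ->]]] /fintype.subsetP/(_ i (finset.set21 _ _)) h1.
move=> /fintype.subsetP/(_ i (finset.set21 _ _)) h2; move: h1 h2; rewrite I1P I2P.
by move=> /andP[_ h1] /andP[h2 _]; have := ltn_trans h1 h2; rewrite ltnn.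
Qed.

Lemma top_not_below S : S = I1 \/ S = I2 -> top \subset S = false.
Proof.
by move=> h; apply/negP => /fintype.subsetP/(_ c (finset.set22 _ _)); case: h => ->;
  rewrite ?I1P ?I2P ltnn ?andbF.
Qed.

Lemma pairing_below P S : pairing (interval a b) P -> S = I1 \/ S = I2 ->
  is_noncrossing P -> top \in P -> pairing S (below P S) && is_noncrossing (below P S).
Proof.
move=> pP hS0 ncr topP; have /pairingP[two sub cov eqv] := pP.
(* [S'] is the opposite side. The block of a point of [S] is neither [top] nor contained in [S'], so
   [block_below] places it inside [S]. *)
have [S' hS] : exists S', S = I1 /\ S' = I2 \/ S = I2 /\ S' = I1.
  by case: hS0 => ->; [exists I2; left|exists I1; right].
apply/andP; split.
  apply/pairingP; split=> [B|B|i Si|B C i].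
  - by rewrite finset.inE => /andP[/two].
  - by rewrite finset.inE => /andP[].
  - have Ii : i \in interval a b.
      case: hS => -[eS _]; move: Si; rewrite eS ?I1P ?I2P in_interval.
        by move=> /andP[ai ic]; rewrite (ltnW ai) (ltn_trans ic cb).
      by move=> /andP[ci ->]; rewrite (ltnW (ltn_trans ac ci)).
    have [B PB iB] := cov _ Ii; exists B => //; rewrite finset.inE PB /=.
    have iS' : i \notin S'.
      apply/negP => iS'; move: Si iS'.
      by case: hS => -[-> ->]; rewrite I1P I2P; lia.
    have itop : i \notin top.
      by rewrite !finset.inE -!val_eqE /= ea; case: hS => -[eS _]; move: Si; rewrite eS ?I1P ?I2P; lia.
    case: (block_below pP ncr topP PB) => [e|]; first by rewrite -e iB in itop.
    have BS' : B \subset S' -> B \subset S by move=> /fintype.subsetP/(_ _ iB) h; rewrite h in iS'.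
    by case: hS BS' => -[-> ->] BS' [].
  - by rewrite !finset.inE => /andP[PB _] /andP[PC _]; apply: eqv.
apply/noncrossingP => i j l m ij jl lm.
rewrite !finset.inE => /andP[h1 _] /andP[h2 _].
by move/noncrossingP/(_ i j l m): ncr; apply.
Qed.

Definition assemble (p : {set {set 'I_N}} * {set {set 'I_N}}) := top |: (p.1 :|: p.2).

Lemma assemble_below P : pairing (interval a b) P -> is_noncrossing P -> top \in P ->
  assemble (below P I1, below P I2) = P.
Proof.
move=> pP ncr topP; apply/finset.setP => B; rewrite !finset.inE.
apply/idP/idP => [/or3P[/eqP -> //|/andP[] //|/andP[] //]|PB].
by case: (block_below pP ncr topP PB) => [->|[h|h]]; rewrite ?eqxx // PB h ?orbT.
Qed.

Let sub_disjoint p1 p2 : pairing I1 p1 -> pairing I2 p2 -> [disjoint p1 & p2].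
Proof.
move=> /pairingP[two1 sub1 _ _] /pairingP[_ sub2 _ _].
rewrite finset.disjoints_subset; apply/fintype.subsetP => B B1; rewrite finset.inE.
by apply/negP => B2; apply: (block_not_both (two1 _ B1)); [exact: sub1|exact: sub2].
Qed.

Let top_notin p1 p2 : pairing I1 p1 -> pairing I2 p2 -> top \notin p1 :|: p2.
Proof.
move=> /pairingP[_ sub1 _ _] /pairingP[_ sub2 _ _]; rewrite finset.inE.
apply/norP; split; apply/negP.
  by move/sub1; rewrite top_not_below //; left.
by move/sub2; rewrite top_not_below //; right.
Qed.

Lemma below_assemble p1 p2 : pairing I1 p1 -> pairing I2 p2 ->
  below (assemble (p1, p2)) I1 = p1 /\ below (assemble (p1, p2)) I2 = p2.
Proof.
move=> /pairingP[two1 sub1 _ _] /pairingP[two2 sub2 _ _].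
split; apply/finset.setP => B; rewrite !finset.inE; apply/idP/idP.
- case/andP => /or3P[/eqP ->| // |B2] h; first by rewrite top_not_below // in h; left.
  by case: (block_not_both (two2 _ B2) h (sub2 _ B2)).
- by move=> B1; rewrite B1 orbT /=; apply: sub1.
- case/andP => /or3P[/eqP ->|B1| //] h; first by rewrite top_not_below // in h; right.
  by case: (block_not_both (two1 _ B1) (sub1 _ B1) h).
- by move=> B2; rewrite B2 !orbT /=; apply: sub2.
Qed.

Lemma pairing_assemble p1 p2 : pairing I1 p1 -> pairing I2 p2 ->
  pairing (interval a b) (assemble (p1, p2)).
Proof.
move=> /pairingP[two1 sub1 cov1 eqv1] /pairingP[two2 sub2 cov2 eqv2].
have in1 B i : B \in p1 -> i \in B -> (a < i < c)%N.
  by move=> /sub1/fintype.subsetP h /h; rewrite I1P.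
have in2 B i : B \in p2 -> i \in B -> (c < i < b)%N.
  by move=> /sub2/fintype.subsetP h /h; rewrite I2P.
have in0 i : i \in top -> i = a :> nat \/ i = c :> nat.
  by rewrite !finset.inE => /orP[] /eqP ->; [left|right].
apply/pairingP; split=> [B|B|i|B C i].
- rewrite !finset.inE => /or3P[/eqP ->|/two1 //|/two2 //].
  by rewrite finset.cards2 -val_eqE /= ltn_eqF.
- move=> hB; apply/fintype.subsetP => i iB; rewrite in_interval.
  move: hB; rewrite !finset.inE => /or3P[/eqP e|/in1/(_ iB)|/in2/(_ iB)]; try lia.
  by move: iB; rewrite e => /in0[]->; lia.
- rewrite in_interval => hi.
  have [e|ne] := eqVneq (i : nat) a.
    exists top; first by rewrite !finset.inE eqxx.
    by rewrite !finset.inE -val_eqE /= ea e eqxx.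
  case: (ltngtP i c) => h.
  + have /cov1[B B1 iB] : i \in I1 by rewrite I1P; lia.
    by exists B => //; rewrite !finset.inE B1 orbT.
  + have /cov2[B B1 iB] : i \in I2 by rewrite I2P; lia.
    by exists B => //; rewrite !finset.inE B1 !orbT.
  + exists top; first by rewrite !finset.inE eqxx.
    by rewrite !finset.inE -!val_eqE /= h eqxx orbT.
- rewrite !finset.inE => /or3P[/eqP ->|B1|B2] /or3P[/eqP ->|C1|C2] // iB iC.
  + by have := in1 _ _ C1 iC; case: (in0 _ iB) => ->; lia.
  + by have := in2 _ _ C2 iC; case: (in0 _ iB) => ->; lia.
  + by have := in1 _ _ B1 iB; case: (in0 _ iC) => ->; lia.
  + exact: (eqv1 _ _ i).
  + by have := in1 _ _ B1 iB; have := in2 _ _ C2 iC; lia.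
  + by have := in2 _ _ B2 iB; case: (in0 _ iC) => ->; lia.
  + by have := in2 _ _ B2 iB; have := in1 _ _ C1 iC; lia.
  + exact: (eqv2 _ _ i).
Qed.

Lemma noncrossing_assemble p1 p2 : pairing I1 p1 -> pairing I2 p2 ->
  is_noncrossing p1 -> is_noncrossing p2 -> is_noncrossing (assemble (p1, p2)).
Proof.
move=> /pairingP[_ sub1 _ _] /pairingP[_ sub2 _ _] /noncrossingP nc1 /noncrossingP nc2.
have in1 i j : [set i; j] \in p1 -> (a < i < c)%N /\ (a < j < c)%N.
  move=> /sub1/fintype.subsetP h; rewrite -!I1P; split; apply: h; first exact: finset.set21.
  exact: finset.set22.
have in2 i j : [set i; j] \in p2 -> (c < i < b)%N /\ (c < j < b)%N.
  move=> /sub2/fintype.subsetP h; rewrite -!I2P; split; apply: h; first exact: finset.set21.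
  exact: finset.set22.
have in0 (i j : 'I_N) : (i < j)%N -> [set i; j] = top -> i = a :> nat /\ j = c :> nat.
  by move=> ij /(pair_set_inj ij a'c)[-> ->].
apply/noncrossingP => i j l m ij jl lm.
have il := ltn_trans ij jl; have jm := ltn_trans jl lm.
rewrite !finset.inE => /or3P[/eqP/(in0 _ _ il) [h1 h2]|h|h] /or3P[/eqP/(in0 _ _ jm) [h3 h4]|h'|h'].
- lia.
- by have := in1 _ _ h'; lia.
- by have := in2 _ _ h'; lia.
- by have := in1 _ _ h; lia.
- exact: (nc1 i j l m).
- by have := in1 _ _ h; have := in2 _ _ h'; lia.
- by have := in2 _ _ h; lia.
- by have := in2 _ _ h; have := in1 _ _ h'; lia.
- exact: (nc2 i j l m).
Qed.

(** [assemble] and [below] are inverse bijections between the non-crossing pairings that contain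
    [top] and the pairs of non-crossing pairings of its two sides. *)
Lemma noncrossing_sum_split :
  \sum_(P | (pairing (interval a b) P && is_noncrossing P) && (top \in P)) pairing_weight P =
  w a' c * noncrossing_sum I1 * noncrossing_sum I2.
Proof.
rewrite (reindex_onto assemble (fun P => (below P I1, below P I2))); last first.
  by move=> P /andP[/andP[pP ncr] topP]; apply: assemble_below.
rewrite /noncrossing_sum -mulrA big_distrlr /= pair_big /= mulr_sumr.
apply: eq_big => [[p1 p2]|[p1 p2]] /=.
  apply/idP/idP => [/andP[/andP[/andP[pP ncr] topP] /eqP[e1 e2]]|].
    rewrite -[p1 in X in X && _]e1 -[p2 in X in _ && X]e2.
    by apply/andP; split; apply: pairing_below => //; [left|right].
  move=> /andP[/andP[pr1 nc1] /andP[pr2 nc2]].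
  have [-> ->] := below_assemble pr1 pr2.
  by rewrite pairing_assemble // noncrossing_assemble // eqxx andbT !finset.inE eqxx.
move=> /andP[/andP[/andP[pP ncr] topP] /eqP[e1 e2]].
have /andP[pr1 _] : pairing I1 p1 && is_noncrossing p1.
  by rewrite -e1; apply: pairing_below pP _ ncr topP; left.
have /andP[pr2 _] : pairing I2 p2 && is_noncrossing p2.
  by rewrite -e2; apply: pairing_below pP _ ncr topP; right.
rewrite !pairing_weightE big_setU1 /=; last exact: top_notin.
rewrite block_weight_pair //; congr (_ * _).
rewrite (eq_bigl [predU p1 & p2]); last by move=> B; rewrite !finset.inE.
by rewrite bigU //; apply: sub_disjoint.
Qed.

End Split.

Lemma noncrossing_sum_rec a b (a' : 'I_N) : a' = a :> nat -> (a < b)%N -> (b <= N)%N ->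
  noncrossing_sum (interval a b) =
  \sum_(c : 'I_N | (a < c < b)%N)
     w a' c * noncrossing_sum (interval a.+1 c) * noncrossing_sum (interval c.+1 b).
Proof.
move=> ea ab bN.
under [RHS]eq_bigr => c /andP[ac cb] do rewrite -(noncrossing_sum_split ea ac cb).
(* After the exchange each [P] must be counted once: the only [c] with [[set a'; c]] in [P] is the
   partner of [a'], which lies to its right because [a'] is the least point. *)
rewrite (exchange_big_dep (fun P => pairing (interval a b) P && is_noncrossing P)) /=; last first.
  by move=> c P _ /andP[].
apply: eq_bigr => P pPn; have /andP[/pairingP[two sub cov eqv] ncr] := pPn.
have [B PB aB] : exists2 B, B \in P & a' \in B.
  by apply: cov; rewrite in_interval ea leqnn ab.
have [i [j [ij eB]]] := pair_set_ordered (two _ PB).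
have iab : (a <= i < b)%N by rewrite -in_interval; apply: (fintype.subsetP (sub _ PB)); rewrite eB finset.set21.
have jab : (a <= j < b)%N by rewrite -in_interval; apply: (fintype.subsetP (sub _ PB)); rewrite eB finset.set22.
have ei : i = a'.
  by move: aB; rewrite eB !finset.inE => /orP[/eqP //|/eqP e]; move: ea iab ij; rewrite e; lia.
rewrite (big_pred1 j) // => c; rewrite pPn /=.
apply/idP/eqP => [/andP[/andP[ac cb] hP]|->].
  have e : [set a'; c] = B by apply: (eqv _ _ a') => //; rewrite finset.set21.
  have ij' : (a' < j)%N by rewrite -ei.
  have ac' : (a' < c)%N by rewrite ea.
  by have [_ ->] := pair_set_inj ac' ij' (etrans e (etrans eB (congr1 (fun z => [set z; j]) ei))).
rewrite -ei -eB PB andbT; move: ij; rewrite ei ea => ->; by case/andP: jab.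
Qed.

End NonCrossingPairings.
(** * Convergence of moments *)

Lemma inv_sqrt_small (R : realType) (D e : R) : 0 < e -> exists N : nat, (0 < N)%N /\
  forall n : nat, (N <= n)%N -> (Num.sqrt n%:R)^-1 * D < e.
Proof.
move=> e0; set t := (`|D| / e) ^+ 2.
have t0 : 0 <= t by rewrite sqr_ge0.
exists (Num.bound t).+1; split=> // n hn.
have tn : t < n%:R.
  by apply: lt_le_trans (archi_boundP t0) _; rewrite ler_nat ltnW.
have n0 : 0 < n%:R :> R by exact: le_lt_trans t0 tn.
rewrite ltr_pdivrMl ?sqrtr_gt0 // mulrC; apply: le_lt_trans (ler_norm D) _.
rewrite -ltr_pdivrMl // mulrC.
have De : 0 <= `|D| / e by rewrite divr_ge0 // ltW.
have -> : `|D| / e = Num.sqrt t by rewrite /t sqrtr_sqr (ger0_norm De).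
by rewrite ltr_sqrt.
Qed.

Lemma le_of_inv_sqrt (R : realType) (D a b : R) :
  (forall n : nat, (0 < n)%N -> a <= b + (Num.sqrt n%:R)^-1 * D) -> a <= b.
Proof.
move=> h; apply: le_eps => e e0; have [N [N0 hN]] := inv_sqrt_small D e0.
by apply: le_trans (h _ N0) _; rewrite lerD2l ltW // hN.
Qed.

Section GeometricSums.
Variable R : realFieldType.

(** The recursion produces this sum and its mirror image; together they are at most two thirds of
    the next power of 4, which lets the induction in [moment_error] close. *)
Lemma geometric_sum_up a m :
  3 * \sum_(a <= c < a + m) 4 ^+ (c - a) <= 4 ^+ m :> R.
Proof.
elim: m => [|m ih]; first by rewrite addn0 big_geq // mulr0 expr0.
rewrite addnS big_nat_recr ?leq_addr //= addKn exprS mulrDr.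
lra.
Qed.

Lemma geometric_sum_down a m :
  3 * \sum_(a <= c < a + m) 4 ^+ (a + m - c.+1) <= 4 ^+ m :> R.
Proof.
elim: m a => [|m ih] a; first by rewrite addn0 big_geq // mulr0 expr0.
rewrite -addSnnS big_ltn; last by rewrite addSn ltnS leq_addr.
rewrite addKn exprS mulrDr; have := ih a.+1.
lra.
Qed.

Lemma natr_sqr_le_expr4 r : r%:R ^+ 2 <= 4 ^+ r :> R.
Proof.
have -> : 4 ^+ r = (2 ^+ r) ^+ 2 :> R.
  by rewrite exprAC; congr (_ ^+ _); rewrite expr2 -natrM.
by rewrite ler_pXn2r ?nnegrE ?exprn_ge0 // -natrX ler_nat ltnW // ltn_expl.
Qed.

End GeometricSums.

Section MomentConvergence.
Variables (R : realType) (A : cstarAlgType R) (tau : {scalar A}).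
Hypotheses (htau : is_state tau) (hfaithful : is_faithful tau).
Variables (d : nat) (x : nat -> 'I_d -> A).
Hypothesis hfree : free_sets tau x.
Hypothesis hsa : forall i k, self_adjoint (x i k).
Hypothesis hcentered : forall i k, tau (x i k) = 0.
Variable M : R.
Hypothesis M_ge1 : 1 <= M.
Hypothesis hbound : forall i k, cnorm (x i k) <= M.
Variable Sigma : 'M[R[i]]_d.
Hypothesis hSigma : forall i k l, Sigma k l = tau (x i k * x i l).

Variables (k : nat -> 'I_d) (N : nat) (sc : nat -> nat -> R[i]).
Hypothesis sc_nil : forall a, sc a a = 1.
Hypothesis sc_rec : forall a b, (a < b)%N -> (b <= N)%N ->
  sc a b = \sum_(a.+1 <= c < b) Sigma (k a) (k c) * sc a.+1 c * sc c.+1 b.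

Let K : R := 3 * M.
Let K_ge0 : 0 <= K. Proof. by rewrite mulr_ge0 // (le_trans ler01). Qed.
Let W n a b : A := \prod_(a <= j < b) clt_sum x n (k j).

(** The bound passes from the moments of [clt_sum] to their limit as [n] grows, in place of a count
    of non-crossing pairings. *)
Let sc_le a b :
  (forall n, (0 < n)%N -> nc (tau (W n a b) - sc a b) <=
    (Num.sqrt n%:R)^-1 * (4 * (4 * (3 * M)) ^+ (b - a))) ->
  nc (sc a b) <= K ^+ (b - a).
Proof.
move=> h; apply: (@le_of_inv_sqrt _ (4 * (4 * (3 * M)) ^+ (b - a))) => n n0.
apply: le_trans (nc_tri _ (tau (W n a b))) _; rewrite nc_B; apply: lerD; last exact: h.
apply: le_trans (state_le_cnorm htau _) _.
exact: (clt_word_cnorm htau hfaithful hfree hsa hcentered M_ge1 hbound n0).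
Qed.

Lemma moment_error a b n : (a <= b)%N -> (b <= N)%N -> (0 < n)%N ->
  nc (tau (\prod_(a <= j < b) clt_sum x n (k j)) - sc a b) <=
  (Num.sqrt n%:R)^-1 * (4 * (4 * (3 * M)) ^+ (b - a)).
Proof.
rewrite -/(W n a b).
(* [n] is generalized because [sc_le] takes the induction hypothesis at all [n] at once. *)
have [m e] := ubnP (b - a)%N; elim: m a b e n => // m ih a b e n ab bN n0.
set eps := (Num.sqrt n%:R)^-1.
have eps0 : 0 <= eps by rewrite invr_ge0 sqrtr_ge0.
have [ba|lt] := leqP b a.
  have -> : b = a by apply/eqP; rewrite eqn_leq ab ba.
  rewrite /W big_geq // htau.2 sc_nil subrr Normc.normc0.
  by rewrite !mulr_ge0 ?exprn_ge0 // mulr_ge0.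
have SD := schwinger_dyson htau hfaithful hfree hsa hcentered M_ge1 hbound hSigma n0 k lt.
rewrite -/(W n a b) -/eps in SD.
set mains := \sum_(a.+1 <= c < b) _ in SD.
have -> : tau (W n a b) - sc a b = (tau (W n a b) - mains) + (mains - sc a b).
  by rewrite addrA subrK.
apply: le_trans (le_normcD _ _) _.
set r := (b - a)%N.
have rest : nc (mains - sc a b) <= eps * (4 * K ^+ r * (2 / 3 * 4 ^+ r.-1)).
  rewrite sc_rec // /mains -sumrB; apply: le_trans (nc_sum _ _ _) _.
  apply: le_trans (_ : \sum_(a.+1 <= c < b) eps * (4 * K ^+ r) *
      (4 ^+ (c - a.+1) + 4 ^+ (b - c.+1)) <= _).
    rewrite !big_nat; apply: ler_sum => c /andP[ac cb].
    set u := (c - a.+1)%N; set v := (b - c.+1)%N.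
    have h1 : nc (tau (W n a.+1 c) - sc a.+1 c) <= eps * (4 * (4 * K) ^+ u).
      by apply: ih => //; lia.
    have h2 : nc (tau (W n c.+1 b) - sc c.+1 b) <= eps * (4 * (4 * K) ^+ v).
      by apply: ih => //; lia.
    have h3 : nc (sc a.+1 c) <= K ^+ u by apply: sc_le => n' n'0; apply: ih => //; lia.
    have h4 : nc (tau (W n c.+1 b)) <= K ^+ v.
      apply: le_trans (state_le_cnorm htau _) _.
      exact: (clt_word_cnorm htau hfaithful hfree hsa hcentered M_ge1 hbound n0).
    rewrite -/(W n a.+1 c) -/(W n c.+1 b).
    set p := tau (W n a.+1 c) in h1 *; set q := tau (W n c.+1 b) in h2 h4 *.
    set p' := sc a.+1 c in h1 h3 *; set q' := sc c.+1 b in h2 *.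
    have -> : Sigma (k a) (k c) * p * q - Sigma (k a) (k c) * p' * q' =
      Sigma (k a) (k c) * ((p - p') * q + p' * (q - q')) by ring.
    rewrite Normc.normcM.
    have hS : nc (Sigma (k a) (k c)) <= K ^+ 2.
      apply: le_trans (nc_Sigma htau hbound hSigma _ _) _.
      rewrite ler_pXn2r ?nnegrE // ?(le_trans ler01) //.
      by rewrite /K ler_peMl ?(le_trans ler01 M_ge1) // ler1n.
    have Ku : 0 <= K ^+ u by rewrite exprn_ge0.
    have Kv : 0 <= K ^+ v by rewrite exprn_ge0.
    have hD : nc ((p - p') * q + p' * (q - q')) <=
       eps * (4 * (4 * K) ^+ u) * K ^+ v + K ^+ u * (eps * (4 * (4 * K) ^+ v)).
      apply: le_trans (le_normcD _ _) _; rewrite !Normc.normcM.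
      by apply: lerD; apply: ler_pM; rewrite ?nc_ge0.
    apply: le_trans (ler_pM (nc_ge0 _) (nc_ge0 _) hS hD) _.
    have er : r = (u + v).+2 by exact: interval_split.
    have -> : K ^+ r = K ^+ 2 * (K ^+ u * K ^+ v) by rewrite er -addn2 exprD mulrC exprD.
    rewrite (exprMn u 4 K) (exprMn v 4 K) le_eqVlt; apply/orP; left; apply/eqP; ring.
  rewrite -mulr_sumr big_split /= -!mulrA !ler_wpM2l ?mulr_ge0 ?exprn_ge0 //.
  have g1 := geometric_sum_up R a.+1 r.-1.
  have g2 := geometric_sum_down R a.+1 r.-1.
  have e2 : (a.+1 + r.-1 = b)%N by rewrite /r; lia.
  rewrite e2 in g1 g2; lra.
(* In units of [eps * (4 * K) ^+ r] the two errors are at most 2 and 2/3, within the claimed 4. *)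
apply: le_trans (lerD SD rest) _; rewrite -/r -/K -mulrDr ler_wpM2l //.
have hr := natr_sqr_le_expr4 R r.
have Kr : 0 <= K ^+ r by rewrite exprn_ge0.
have er : 4 ^+ r = 4 * 4 ^+ r.-1 :> R by rewrite -exprS prednK // subn_gt0.
have hK : r%:R ^+ 2 * K ^+ r <= 4 ^+ r * K ^+ r by rewrite ler_wpM2r.
have p4 : 0 <= 4 ^+ r * K ^+ r by rewrite mulr_ge0 // exprn_ge0.
rewrite (exprMn r 4 K); have -> : 2 / 3 * 4 ^+ r.-1 = 1 / 6 * 4 ^+ r :> R by rewrite er; field.
lra.
Qed.

End MomentConvergence.

Lemma ord_fun_extension (d : nat) (r : nat) (k : 'I_r -> 'I_d) (k0 : 'I_d) :
  exists k' : nat -> 'I_d, forall j : 'I_r, k' j = k j.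
Proof.
exists (fun j => if insub j is Some j' then k j' else k0) => j.
by rewrite valK.
Qed.

Section SemicircularMoments.
Variables (R : realType) (A : cstarAlgType R) (tau : {scalar A}).
Hypotheses (htau : is_state tau) (hfaithful : is_faithful tau).
Variables (d : nat) (x : nat -> 'I_d -> A).
Hypothesis hd : (0 < d)%N.
Hypothesis hfree : free_sets tau x.
Hypothesis hsa : forall i k, self_adjoint (x i k).
Hypothesis hcentered : forall i k, tau (x i k) = 0.
Variable M : R.
Hypothesis M_ge1 : 1 <= M.
Hypothesis hbound : forall i k, cnorm (x i k) <= M.
Variable Sigma : 'M[R[i]]_d.
Hypothesis hSigma : forall i k l, Sigma k l = tau (x i k * x i l).

Lemma semicircular_moment_error r (k : 'I_r -> 'I_d) n : (0 < n)%N ->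
  nc (tau (\prod_(j < r) clt_sum x n (k j)) - semicircular_moment Sigma k) <=
  (Num.sqrt n%:R)^-1 * (4 * (4 * (3 * M)) ^+ r).
Proof.
move=> n0; have [k' hk'] := ord_fun_extension k (Ordinal hd).
pose w (i j : 'I_r) := Sigma (k i) (k j).
pose sc a b := noncrossing_sum w (interval r a b).
have e1 : semicircular_moment Sigma k = sc 0%N r.
  rewrite /sc; have -> : interval r 0 r = [set: 'I_r]%SET.
    by apply/finset.setP => j; rewrite !finset.inE ltn_ord.
  by [].
have e2 : \prod_(j < r) clt_sum x n (k j) = \prod_(0 <= j < r) clt_sum x n (k' j).
  by rewrite big_mkord; apply: eq_bigr => j _; rewrite hk'.
rewrite e1 e2 -[X in _ ^+ X](subn0 r).
apply: (moment_error htau hfaithful hfree hsa hcentered M_ge1 hbound hSigma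
  (N := r) (sc := sc)) => //.
  by move=> a; exact: noncrossing_sum_nil.
move=> a b ab br; have ar := leq_trans ab br.
rewrite /sc (@noncrossing_sum_rec _ _ w a b (Ordinal ar)) //.
rewrite (big_nat_widen _ _ _ _ _ br) big_geq_mkord.
by apply: eq_big => c /=; [rewrite andbC|rewrite /w hk' -(hk' (Ordinal ar))].
Qed.

End SemicircularMoments.
(** * Cauchy transforms *)

Section Resolvent.
Variables (R : realType) (A : cstarAlgType R).
Implicit Types (a : A) (z : R[i]).

Definition neumann_sum z a m : A := \sum_(j < m) (z^-1 ^+ j.+1) *: a ^+ j.

(** For [t = 1 / |z|] and [t * L < 1] the whole series is [1 / (|z| - L)], at most 1. Adding the
    remainder [(t * L) ^+ m] gives a quantity that does not increase with [m]. *)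
Lemma geometric_resolvent_bound (t L : R) m : 0 <= t -> 0 <= L -> t * (L + 1) <= 1 ->
  \sum_(j < m) t ^+ j.+1 * L ^+ j <= 1.
Proof.
move=> t0 L0 tL.
suff h : \sum_(j < m) t ^+ j.+1 * L ^+ j + (t * L) ^+ m <= 1.
  by apply: le_trans h; rewrite lerDl exprn_ge0 // mulr_ge0.
elim: m => [|m ih]; first by rewrite big_ord0 expr0 add0r.
rewrite big_ord_recr /= -addrA; apply: le_trans ih; rewrite lerD2l.
have -> : t ^+ m.+1 * L ^+ m + (t * L) ^+ m.+1 = (t * L) ^+ m * (t * (L + 1)).
  by rewrite !exprMn !exprS; ring.
by rewrite ler_piMr // exprn_ge0 // mulr_ge0.
Qed.

Variables (a : A) (z : R[i]) (L : R).
Hypotheses (aL : cnorm a <= L) (zL : L + 1 <= nc z).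

Let L0 : 0 <= L := le_trans (cnorm_ge0 a) aL.
Let nz0 : 0 < nc z. Proof. exact: lt_le_trans (ltr_wpDl L0 ltr01) zL. Qed.
Let z0 : z != 0. Proof. by apply: contraTneq nz0 => ->; rewrite Normc.normc0 ltxx. Qed.

Let nzV : (nc z)^-1 * (L + 1) <= 1.
Proof. by rewrite ler_pdivrMl // mulr1. Qed.

Let neumann_step m : neumann_sum z a m.+1 - neumann_sum z a m = (z^-1 ^+ m.+1) *: a ^+ m.
Proof. by rewrite /neumann_sum big_ord_recr /= addrAC subrr add0r. Qed.

Let comm_neumann m : GRing.comm (z%:A - a) (neumann_sum z a m).
Proof.
apply: commr_sum => j _; rewrite /GRing.comm -scalerAr -scalerAl; congr (_ *: _).
by rewrite mulrBl mulrBr -scalerAl -scalerAr mul1r mulr1 -exprS -exprSr.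
Qed.

Let neumann_resolvent m :
  (z%:A - a) * neumann_sum z a m = 1 - z *: (neumann_sum z a m.+1 - neumann_sum z a m).
Proof.
rewrite neumann_step scalerA exprS mulrA divff // mul1r.
elim: m => [|m ih].
  by rewrite /neumann_sum big_ord0 mulr0 !expr0 scale1r subrr.
have -> : neumann_sum z a m.+1 = neumann_sum z a m + z^-1 ^+ m.+1 *: a ^+ m.
  by rewrite -neumann_step addrC subrK.
rewrite mulrDr ih -scalerAr mulrBl -scalerAl mul1r -exprS scalerBr scalerA.
have -> : z^-1 ^+ m.+1 * z = z^-1 ^+ m by rewrite exprSr mulrAC -mulrA divff // mulr1.
by rewrite addrA subrK.
Qed.

Lemma resolvent_neumann :
  (z%:A - a) \is a GRing.unit /\ limit_of (neumann_sum z a) ((z%:A - a)^-1).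
Proof.
have dom m : cnorm (neumann_sum z a m.+1 - neumann_sum z a m) <=
    \sum_(j < m.+1) (nc z)^-1 ^+ j.+1 * L ^+ j - \sum_(j < m) (nc z)^-1 ^+ j.+1 * L ^+ j.
  rewrite neumann_step big_ord_recr /= [leRHS]addrAC subrr add0r cnormZ nc_X Normc.normcV.
  rewrite ler_wpM2l ?exprn_ge0 ?invr_ge0 ?(ltW nz0) //.
  apply: le_trans (cnorm_X _ _) _.
  by rewrite lerXn2r ?nnegrE ?cnorm_ge0.
have [l hl] : exists l, limit_of (neumann_sum z a) l.
  apply: (dominated_limit (t := fun m => \sum_(j < m) (nc z)^-1 ^+ j.+1 * L ^+ j) (K := 1)) => // m.
  by apply: geometric_resolvent_bound => //; rewrite invr_ge0 ltW.
(* The residual is [z] times an increment of a convergent sequence. *)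
have small e : 0 < e -> exists m, cnorm (neumann_sum z a m - l) < e /\
    cnorm ((z%:A - a) * neumann_sum z a m - 1) < e.
  move=> e0; have k0 : 0 < 2 * (nc z + 1) by rewrite mulr_gt0 // ltr_wpDl // nc_ge0.
  have [N1 h1] := hl _ e0; have [N2 h2] := hl _ (divr_gt0 e0 k0).
  exists (maxn N1 N2); split; first by apply: h1; exact: leq_maxl.
  rewrite neumann_resolvent addrAC subrr add0r cnormN cnormZ.
  have i1 := h2 (maxn N1 N2) (leq_maxr _ _).
  have i2 := h2 (maxn N1 N2).+1 (leq_trans (leq_maxr _ _) (leqnSn _)).
  set u := neumann_sum z a _ in i1 *; set v := neumann_sum z a _ in i2 *.
  have i3 : cnorm (v - u) <= cnorm (v - l) + cnorm (u - l).
    have -> : v - u = (v - l) - (u - l) by rewrite opprB addrA subrK.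
    by apply: le_trans (cnormD _ _) _; rewrite cnormN.
  have i4 : cnorm (v - u) < e / (nc z + 1).
    have -> : e / (nc z + 1) = e / (2 * (nc z + 1)) + e / (2 * (nc z + 1)).
      by field; rewrite !gt_eqF // ltr_wpDl // ltW.
    lra.
  apply: le_lt_trans (_ : (nc z + 1) * cnorm (v - u) < _).
    by rewrite ler_wpM2r ?cnorm_ge0 // lerDl.
  by rewrite -ltr_pdivlMl ?ltr_wpDl ?(ltW nz0) // mulrC.
(* Treats left and right multiplication by [z%:A - a] together: a Lipschitz map that agrees with the
   former on the partial sums takes the value 1 at the limit. *)
have inv_of (f : A -> A) (c : R) : 0 <= c -> (forall u v, cnorm (f u - f v) <= c * cnorm (u - v)) ->
    (forall m, f (neumann_sum z a m) = (z%:A - a) * neumann_sum z a m) -> f l = 1.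
  move=> c0 fc fu; apply/eqP; rewrite -subr_eq0; apply/eqP/cnorm_small => e e0.
  have k0 : 0 < 2 * (c + 1) by rewrite mulr_gt0 // ltr_wpDl.
  have e1 : 0 < Num.min (e / (2 * (c + 1))) (e / 2) by rewrite lt_min !divr_gt0.
  have [m [m1 m2]] := small _ e1.
  have -> : f l - 1 = (f l - f (neumann_sum z a m)) + (f (neumann_sum z a m) - 1).
    by rewrite addrA subrK.
  apply: le_trans (cnormD _ _) _.
  have i1 := fc l (neumann_sum z a m); rewrite cnormB in m1.
  have i2 : c * cnorm (l - neumann_sum z a m) <= e / 2.
    apply: le_trans (_ : (c + 1) * (e / (2 * (c + 1))) <= _).
      apply: ler_pM => //; first exact: cnorm_ge0; first by rewrite lerDl.
      by apply: le_trans (ltW m1) _; rewrite ge_min lexx.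
    rewrite le_eqVlt; apply/orP; left; apply/eqP; field.
    by rewrite gt_eqF // ltr_wpDl.
  have i3 : cnorm (f (neumann_sum z a m) - 1) <= e / 2.
    by rewrite fu; apply: le_trans (ltW m2) _; rewrite ge_min lexx orbT.
  lra.
have l1 : (z%:A - a) * l = 1.
  apply: (inv_of (fun u => (z%:A - a) * u) (cnorm (z%:A - a))) => //; first exact: cnorm_ge0.
  by move=> u v; rewrite -mulrBr cnormM.
have l2 : l * (z%:A - a) = 1.
  apply: (inv_of (fun u => u * (z%:A - a)) (cnorm (z%:A - a))) => //; first exact: cnorm_ge0.
    by move=> u v; rewrite -mulrBl mulrC cnormM.
  by move=> m; rewrite comm_neumann.
have U : (z%:A - a) \is a GRing.unit by apply/unitrP; exists l.
by split=> //; have -> : (z%:A - a)^-1 = l by rewrite -[RHS](mulKr U) l1 mulr1.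
Qed.

End Resolvent.

(** * Polynomials and the comparison of Cauchy transforms *)

Section Polynomials.
Variables (R : realType) (d : nat).
Implicit Types (l : seq (R[i] * seq 'I_d)).

(** Lists of monomials without collecting equal terms: products need no normalization, and
    [list_weight] becomes exactly multiplicative. *)
Definition list_eval (A : cstarAlgType R) (y : 'I_d -> A) l : A :=
  \sum_(c <- l) c.1 *: \prod_(k <- c.2) y k.

(** A weighted l1 norm of the coefficients. It controls both the norm of an evaluation at elements
    of norm at most [E] and the difference of states of two evaluations. *)
Definition list_weight (E : R) l : R := \sum_(c <- l) nc c.1 * E ^+ size c.2.

Definition list_mul l1 l2 := [seq (c1.1 * c2.1, c1.2 ++ c2.2) | c1 <- l1, c2 <- l2].

Lemma list_eval_mul (A : cstarAlgType R) (y : 'I_d -> A) l1 l2 :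
  list_eval y (list_mul l1 l2) = list_eval y l1 * list_eval y l2.
Proof.
rewrite /list_eval big_allpairs_dep /= big_distrlr /=; apply: eq_bigr => c1 _.
by apply: eq_bigr => c2 _; rewrite big_cat /= -scalerAl -scalerAr scalerA.
Qed.

Lemma list_weight_mul E l1 l2 :
  list_weight E (list_mul l1 l2) = list_weight E l1 * list_weight E l2.
Proof.
rewrite /list_weight big_allpairs_dep /= big_distrlr /=; apply: eq_bigr => c1 _.
by apply: eq_bigr => c2 _; rewrite Normc.normcM size_cat exprD; ring.
Qed.

Definition list_pow l m := iter m (list_mul l) [:: (1, [::])].

Lemma list_eval_pow (A : cstarAlgType R) (y : 'I_d -> A) l m :
  list_eval y (list_pow l m) = list_eval y l ^+ m.
Proof.
elim: m => [|m ih]; last by rewrite exprS -ih -list_eval_mul.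
by rewrite /list_eval big_seq1 /= big_nil scale1r expr0.
Qed.

Lemma list_weight_pow E l m : list_weight E (list_pow l m) = list_weight E l ^+ m.
Proof.
elim: m => [|m ih]; last by rewrite exprS -ih -list_weight_mul.
by rewrite /list_weight big_seq1 nc1 !expr0 mulr1.
Qed.

Lemma list_eval_cnorm (A : cstarAlgType R) (y : 'I_d -> A) E l :
  (forall k, cnorm (y k) <= E) -> cnorm (list_eval y l) <= list_weight E l.
Proof.
move=> yE; apply: le_trans (cnorm_sum _ _ _) _; apply: ler_sum => c _.
by rewrite cnormZ ler_wpM2l ?nc_ge0 // cnorm_prod.
Qed.

Lemma list_weight_ge0 E l : 0 <= E -> 0 <= list_weight E l.
Proof. by move=> E0; apply: sumr_ge0 => c _; rewrite mulr_ge0 ?nc_ge0 ?exprn_ge0. Qed.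

Lemma nceval_list (p : ncpoly R d) : exists l, forall (A : cstarAlgType R) (y : 'I_d -> A),
  nceval p y = list_eval y l.
Proof.
exists [seq (monalg.mcoeff w p, monalg.fmonom_val w) | w <- finmap.enum_fset (monalg.msupp p)] => A y.
rewrite /nceval monalg.mmapE /list_eval big_map; apply: eq_bigr => w _ /=.
by rewrite -scalerAl mul1r.
Qed.

Lemma list_eval_state_diff (A B : cstarAlgType R) (tau : {scalar A}) (phi : {scalar B})
    (y : 'I_d -> A) (s : 'I_d -> B) (E e : R) l :
  (forall w : seq 'I_d, nc (phi (\prod_(k <- w) s k) - tau (\prod_(k <- w) y k)) <= e * E ^+ size w) ->
  nc (phi (list_eval s l) - tau (list_eval y l)) <= e * list_weight E l.
Proof.
move=> h; rewrite /list_eval !state_sum -sumrB mulr_sumr.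
apply: le_trans (nc_sum _ _ _) _; apply: ler_sum => c _.
by rewrite !stateZ -mulrBr Normc.normcM mulrCA ler_wpM2l ?nc_ge0.
Qed.

(** The [j]-th power of the polynomial has weight [L ^+ j], so its two states differ by at most
    [e * L ^+ j]. In the Neumann sums these errors carry coefficients that add up to at most [e], so
    no constant is lost. *)
Lemma cauchy_transform_diff (A B : cstarAlgType R) (tau : {scalar A}) (phi : {scalar B})
    (y : 'I_d -> A) (s : 'I_d -> B) (E e : R) l (z : R[i]) :
  is_state tau -> is_state phi -> 0 <= e ->
  (forall k, cnorm (y k) <= E) -> (forall k, cnorm (s k) <= E) ->
  (forall w : seq 'I_d, nc (phi (\prod_(k <- w) s k) - tau (\prod_(k <- w) y k)) <= e * E ^+ size w) ->
  list_weight E l + 1 <= nc z ->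
  [/\ cauchy_defined (list_eval s l) z, cauchy_defined (list_eval y l) z &
      nc (cauchy_transform phi (list_eval s l) z - cauchy_transform tau (list_eval y l) z) <= e].
Proof.
move=> htau hphi e0 yE sE hw zL; set L := list_weight E l in zL.
have sL : cnorm (list_eval s l) <= L by exact: list_eval_cnorm.
have yL : cnorm (list_eval y l) <= L by exact: list_eval_cnorm.
have [Us ls] := resolvent_neumann sL zL; have [Uy ly] := resolvent_neumann yL zL.
have L0 : 0 <= L := le_trans (cnorm_ge0 _) yL.
split=> //; apply: le_eps => dl dl0; rewrite /cauchy_transform.
have [N1 h1] := ls _ (divr_gt0 dl0 (ltr0n _ 2)).
have [N2 h2] := ly _ (divr_gt0 dl0 (ltr0n _ 2)).
set m := maxn N1 N2; have i1 := h1 m (leq_maxl _ _); have i2 := h2 m (leq_maxr _ _).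
set u := neumann_sum z (list_eval s l) m in i1; set v := neumann_sum z (list_eval y l) m in i2.
set bs := (_ - _)^-1 in i1 *; set by_ := (_ - _)^-1 in i2 *.
have i3 : nc (phi u - tau v) <= e.
  rewrite /u /v /neumann_sum !state_sum -sumrB; apply: le_trans (nc_sum _ _ _) _.
  apply: le_trans (_ : e * \sum_(j < m) (nc z)^-1 ^+ j.+1 * L ^+ j <= _).
    rewrite mulr_sumr; apply: ler_sum => j _.
    rewrite !stateZ -mulrBr Normc.normcM nc_X Normc.normcV mulrCA.
    rewrite ler_wpM2l ?exprn_ge0 ?invr_ge0 ?nc_ge0 // -!list_eval_pow -list_weight_pow.
    exact: list_eval_state_diff.
  have z0 : 0 < nc z by exact: lt_le_trans (ltr_wpDl L0 ltr01) zL.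
  rewrite ler_piMr // geometric_resolvent_bound ?invr_ge0 ?nc_ge0 //.
  by rewrite ler_pdivrMl // mulr1.
have -> : phi bs - tau by_ = (phi u - tau v) + (tau (v - by_) - phi (u - bs)).
  by rewrite !stateB; ring.
apply: le_trans (le_normcD _ _) (lerD i3 _).
apply: le_trans (le_normcD _ _) _; rewrite normcN.
have j1 := state_le_cnorm htau (v - by_); have j2 := state_le_cnorm hphi (u - bs).
lra.
Qed.

End Polynomials.
(** * The algebra of bounded sequences *)

Section BoundedSequences.
Variables (R : realType) (A : cstarAlgType R).

Record bounded_seq := BoundedSeq {
  bseq_val :> nat -> A;
  bseq_bounded : exists K : R, forall n, cnorm (bseq_val n) <= K }.

Lemma bseq_eq (u v : bounded_seq) : (forall n, u n = v n) -> u = v.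
Proof.
case: u v => [u hu] [v hv] /= /funext e; rewrite e in hu *; congr BoundedSeq.
exact: Prop_irrelevance.
Qed.

HB.instance Definition _ := gen_eqMixin bounded_seq.
HB.instance Definition _ := gen_choiceMixin bounded_seq.

Lemma bseq_const_bounded (a : A) : exists K : R, forall n : nat, cnorm a <= K.
Proof. by exists (cnorm a). Qed.
Definition bseq_const a := BoundedSeq (bseq_const_bounded a).

Lemma bseq_opp_bounded (u : bounded_seq) : exists K : R, forall n, cnorm (- u n) <= K.
Proof. by case: u => u [K hK]; exists K => n; rewrite cnormN. Qed.
Definition bseq_opp u := BoundedSeq (bseq_opp_bounded u).

Lemma bseq_add_bounded (u v : bounded_seq) : exists K : R, forall n, cnorm (u n + v n) <= K.
Proof.
case: u v => u [K hK] [v [L hL]]; exists (K + L) => n.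
exact: le_trans (cnormD _ _) (lerD (hK n) (hL n)).
Qed.
Definition bseq_add u v := BoundedSeq (bseq_add_bounded u v).

Lemma bseq_mul_bounded (u v : bounded_seq) : exists K : R, forall n, cnorm (u n * v n) <= K.
Proof.
case: u v => u [K hK] [v [L hL]]; exists (K * L) => n.
by apply: le_trans (cnormM _ _) _; rewrite ler_pM ?cnorm_ge0 ?hK ?hL.
Qed.
Definition bseq_mul u v := BoundedSeq (bseq_mul_bounded u v).

Lemma bseq_scale_bounded (c : R[i]) (u : bounded_seq) : exists K : R, forall n, cnorm (c *: u n) <= K.
Proof.
case: u => u [K hK]; exists (nc c * K) => n.
by rewrite cnormZ ler_wpM2l ?nc_ge0 ?hK.
Qed.
Definition bseq_scale c u := BoundedSeq (bseq_scale_bounded c u).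

Lemma bseq_star_bounded (u : bounded_seq) : exists K : R, forall n, cnorm (star (u n)) <= K.
Proof. by case: u => u [K hK]; exists K => n; rewrite cnorm_starE. Qed.
Definition bseq_star u := BoundedSeq (bseq_star_bounded u).

Fact bseq_addA : associative bseq_add.
Proof. by move=> u v w; apply: bseq_eq => n; exact: addrA. Qed.
Fact bseq_addC : commutative bseq_add.
Proof. by move=> u v; apply: bseq_eq => n; exact: addrC. Qed.
Fact bseq_add0 : left_id (bseq_const 0) bseq_add.
Proof. by move=> u; apply: bseq_eq => n; exact: add0r. Qed.
Fact bseq_addN : left_inverse (bseq_const 0) bseq_opp bseq_add.
Proof. by move=> u; apply: bseq_eq => n; exact: addNr. Qed.

HB.instance Definition _ :=
  GRing.isZmodule.Build bounded_seq bseq_addA bseq_addC bseq_add0 bseq_addN.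

Fact bseq_mulA : associative bseq_mul.
Proof. by move=> u v w; apply: bseq_eq => n; exact: mulrA. Qed.
Fact bseq_mul1 : left_id (bseq_const 1) bseq_mul.
Proof. by move=> u; apply: bseq_eq => n; exact: mul1r. Qed.
Fact bseq_mulr1 : right_id (bseq_const 1) bseq_mul.
Proof. by move=> u; apply: bseq_eq => n; exact: mulr1. Qed.
Fact bseq_mulDl : left_distributive bseq_mul +%R.
Proof. by move=> u v w; apply: bseq_eq => n; exact: mulrDl. Qed.
Fact bseq_mulDr : right_distributive bseq_mul +%R.
Proof. by move=> u v w; apply: bseq_eq => n; exact: mulrDr. Qed.
Fact bseq_oner_neq0 : bseq_const 1 != 0 :> bounded_seq.
Proof.
apply/eqP => /(congr1 (fun u : bounded_seq => u 0%N)) /= /eqP.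
by rewrite oner_eq0.
Qed.

HB.instance Definition _ := GRing.Zmodule_isNzRing.Build bounded_seq
  bseq_mulA bseq_mul1 bseq_mulr1 bseq_mulDl bseq_mulDr bseq_oner_neq0.

Fact bseq_scaleA (a b : R[i]) (u : bounded_seq) :
  bseq_scale a (bseq_scale b u) = bseq_scale (a * b) u.
Proof. by apply: bseq_eq => n; exact: scalerA. Qed.
Fact bseq_scale1 : left_id 1 bseq_scale.
Proof. by move=> u; apply: bseq_eq => n; exact: scale1r. Qed.
Fact bseq_scaleDr : right_distributive bseq_scale +%R.
Proof. by move=> a u v; apply: bseq_eq => n; exact: scalerDr. Qed.
Fact bseq_scaleDl (u : bounded_seq) : {morph bseq_scale^~ u : a b / a + b}.
Proof. by move=> a b; apply: bseq_eq => n; exact: scalerDl. Qed.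

HB.instance Definition _ := GRing.Zmodule_isLmodule.Build R[i] bounded_seq
  bseq_scaleA bseq_scale1 bseq_scaleDr bseq_scaleDl.

Fact bseq_scalerAl (a : R[i]) (u v : bounded_seq) : a *: (u * v) = (a *: u) * v.
Proof. by apply: bseq_eq => n; exact: scalerAl. Qed.
HB.instance Definition _ := GRing.Lmodule_isLalgebra.Build R[i] bounded_seq bseq_scalerAl.

Fact bseq_scalerAr (a : R[i]) (u v : bounded_seq) : a *: (u * v) = u * (a *: v).
Proof. by apply: bseq_eq => n; exact: scalerAr. Qed.
HB.instance Definition _ := GRing.Lalgebra_isAlgebra.Build R[i] bounded_seq bseq_scalerAr.

Definition bseq_invertible (u : bounded_seq) := exists v, v * u = 1 /\ u * v = 1.
Definition bseq_unit : pred bounded_seq := fun u => `[< bseq_invertible u >].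
Definition bseq_inv (u : bounded_seq) : bounded_seq :=
  if pselect (bseq_invertible u) is left h then sval (cid h) else u.

Fact bseq_mulVr : {in bseq_unit, left_inverse 1 bseq_inv *%R}.
Proof.
move=> u /asboolP hu; rewrite /bseq_inv; case: pselect => // h.
by case: (cid h) => v [].
Qed.
Fact bseq_divrr : {in bseq_unit, right_inverse 1 bseq_inv *%R}.
Proof.
move=> u /asboolP hu; rewrite /bseq_inv; case: pselect => // h.
by case: (cid h) => v [].
Qed.
Fact bseq_unitP (u v : bounded_seq) : v * u = 1 /\ u * v = 1 -> bseq_unit u.
Proof. by move=> h; apply/asboolP; exists v. Qed.
Fact bseq_inv_out : {in [predC bseq_unit], bseq_inv =1 id}.
Proof.
move=> u; rewrite inE => /negP hu; rewrite /bseq_inv; case: pselect => // h.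
by case: hu; apply/asboolP.
Qed.

HB.instance Definition _ := GRing.NzRing_hasMulInverse.Build bounded_seq
  bseq_mulVr bseq_divrr bseq_unitP bseq_inv_out.

Definition bseq_norm (u : bounded_seq) : R := sup (range (fun n => cnorm (u n))).

Lemma cnorm_le_bseq_norm (u : bounded_seq) n : cnorm (u n) <= bseq_norm u.
Proof.
apply: ub_le_sup; last by exists n.
by case: u => u [K hK]; exists K => _ [m _ <-]; exact: hK.
Qed.

Lemma bseq_norm_le (u : bounded_seq) (K : R) : (forall n, cnorm (u n) <= K) -> bseq_norm u <= K.
Proof.
move=> h; apply: ge_sup; first by exists (cnorm (u 0%N)); exists 0%N.
by move=> _ [n _ <-].
Qed.

Lemma bseq_norm_ge0 (u : bounded_seq) : 0 <= bseq_norm u.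
Proof. exact: le_trans (cnorm_ge0 (u 0%N)) (cnorm_le_bseq_norm u 0). Qed.

Fact bseq_starK : involutive bseq_star.
Proof. by move=> u; apply: bseq_eq => n; exact: starK. Qed.
Fact bseq_starD : {morph bseq_star : u v / u + v}.
Proof. by move=> u v; apply: bseq_eq => n; exact: starD. Qed.
Fact bseq_starZ (a : R[i]) (u : bounded_seq) : bseq_star (a *: u) = a^*%C *: bseq_star u.
Proof. by apply: bseq_eq => n; exact: starZ. Qed.
Fact bseq_starM (u v : bounded_seq) : bseq_star (u * v) = bseq_star v * bseq_star u.
Proof. by apply: bseq_eq => n; exact: starM. Qed.

Fact bseq_norm_eq0 (u : bounded_seq) : bseq_norm u = 0 -> u = 0.
Proof.
move=> h; apply: bseq_eq => n; apply: cnorm_eq0; apply/le_anti.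
by rewrite cnorm_ge0 -h cnorm_le_bseq_norm.
Qed.
Fact bseq_normD (u v : bounded_seq) : bseq_norm (u + v) <= bseq_norm u + bseq_norm v.
Proof.
apply: bseq_norm_le => n; apply: le_trans (cnormD _ _) _.
by rewrite lerD ?cnorm_le_bseq_norm.
Qed.
Fact bseq_normZ (a : R[i]) (u : bounded_seq) : bseq_norm (a *: u) = nc a * bseq_norm u.
Proof.
have le (b : R[i]) (v : bounded_seq) : bseq_norm (b *: v) <= nc b * bseq_norm v.
  apply: bseq_norm_le => n; rewrite [(b *: v) n]/(b *: v n) cnormZ.
  by rewrite ler_wpM2l ?nc_ge0 ?cnorm_le_bseq_norm.
apply/le_anti; rewrite le /=.
have [->|a0] := eqVneq a 0; first by rewrite Normc.normc0 mul0r bseq_norm_ge0.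
have na0 : 0 < nc a.
  rewrite lt_neqAle nc_ge0 andbT eq_sym; apply: contra a0 => /eqP.
  by move/Normc.eq0_normc ->.
have := le a^-1 (a *: u); rewrite scalerA mulVf // scale1r Normc.normcV.
by rewrite ler_pdivlMl.
Qed.
Fact bseq_normM (u v : bounded_seq) : bseq_norm (u * v) <= bseq_norm u * bseq_norm v.
Proof.
apply: bseq_norm_le => n; apply: le_trans (cnormM _ _) _.
by rewrite ler_pM ?cnorm_ge0 ?cnorm_le_bseq_norm.
Qed.
Fact bseq_norm_star (u : bounded_seq) : bseq_norm (bseq_star u * u) = bseq_norm u ^+ 2.
Proof.
apply/le_anti/andP; split.
  apply: bseq_norm_le => n; rewrite [X in cnorm X]/(star (u n) * u n) cnorm_star.
  by rewrite ler_pXn2r ?nnegrE ?cnorm_ge0 ?bseq_norm_ge0 ?cnorm_le_bseq_norm.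
have h0 := bseq_norm_ge0 (bseq_star u * u).
rewrite -[leRHS]sqr_sqrtr // ler_pXn2r ?nnegrE ?sqrtr_ge0 ?bseq_norm_ge0 //.
apply: bseq_norm_le => n.
rewrite -(@ler_pXn2r _ 2) ?nnegrE ?sqrtr_ge0 ?cnorm_ge0 // sqr_sqrtr // -cnorm_star.
exact: (cnorm_le_bseq_norm (bseq_star u * u) n).
Qed.

(** Limits are taken coordinatewise; the Cauchy estimate passes to them uniformly in the coordinate,
    which gives boundedness as well as convergence in the supremum norm. *)
Fact bseq_complete (u : nat -> bounded_seq) :
  (forall e : R, 0 < e -> exists N : nat, forall m n : nat,
     (N <= m)%N -> (N <= n)%N -> bseq_norm (u m - u n) < e) ->
  exists l : bounded_seq, forall e : R, 0 < e -> exists N : nat, forall n : nat,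
     (N <= n)%N -> bseq_norm (u n - l) < e.
Proof.
move=> cauchy.
have pt j : exists a : A, limit_of (fun n => u n j) a.
  apply: cnorm_complete => e /cauchy[N hN]; exists N => m n Nm Nn.
  exact: le_lt_trans (cnorm_le_bseq_norm (u m - u n) j) (hN _ _ Nm Nn).
have [l hl] := choice pt.
have unif e : 0 < e -> exists N : nat, forall n j, (N <= n)%N -> cnorm (u n j - l j) <= e.
  move=> e0; have [N hN] := cauchy _ e0; exists N => n j Nn.
  apply: le_eps => dl dl0; have [N' hN'] := hl j _ dl0.
  set m := maxn N N'; have i1 := hN' m (leq_maxr _ _).
  have i2 := hN n m Nn (leq_maxl _ _).
  have -> : u n j - l j = (u n j - u m j) + (u m j - l j) by rewrite addrA subrK.
  apply: le_trans (cnormD _ _) _.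
  have := cnorm_le_bseq_norm (u n - u m) j; rewrite [X in cnorm X <= _]/(u n j - u m j).
  lra.
have lb : exists K : R, forall j, cnorm (l j) <= K.
  have [N hN] := unif 1 ltr01; exists (bseq_norm (u N) + 1) => j.
  apply: le_trans (cnorm_tri _ (u N j)) _; rewrite cnormB.
  by rewrite lerD ?cnorm_le_bseq_norm ?hN.
exists (BoundedSeq lb) => e e0.
have [N hN] := unif _ (divr_gt0 e0 (ltr0n _ 2)); exists N => n Nn.
apply: (@le_lt_trans _ _ (e / 2)); last by lra.
by apply: bseq_norm_le => j; exact: hN.
Qed.

HB.instance Definition _ := isCStarAlgebra.Build R bounded_seq
  bseq_starK bseq_starD bseq_starZ bseq_starM bseq_norm_eq0 bseq_normD
  bseq_normZ bseq_normM bseq_norm_star bseq_complete.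

Fact bseq_const_linear : linear bseq_const.
Proof. by move=> c a b; apply: bseq_eq. Qed.
HB.instance Definition _ :=
  GRing.isLinear.Build R[i] A bounded_seq _ bseq_const bseq_const_linear.

Fact bseq_const_monoid_morphism : monoid_morphism bseq_const.
Proof. by split=> [|a b]; apply: bseq_eq. Qed.
HB.instance Definition _ :=
  GRing.isMonoidMorphism.Build A bounded_seq bseq_const bseq_const_monoid_morphism.

Lemma bseq_prod (I : Type) (s : seq I) (F : I -> bounded_seq) n :
  (\prod_(i <- s) F i) n = \prod_(i <- s) F i n.
Proof. by elim: s => [|i s ih]; rewrite ?big_nil // !big_cons -ih. Qed.

End BoundedSequences.

(** * Limits along an ultrafilter and the limit state *)

Section UltraLimit.
Variable R : realType.
Implicit Types (u v : nat -> R).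
Local Open Scope classical_set_scope.

Definition bounded_fun u := exists K : R, forall n, `|u n| <= K.

Lemma ultra_fmap (T U : Type) (f : T -> U) (F : set_system T) :
  UltraFilter F -> UltraFilter (f @ F).
Proof.
move=> FU; split; first exact: fmap_proper_filter.
move=> G GP sFG; apply/seteqP; split=> // B GB.
have [//|FnB] := in_ultra_setVsetC (f @^-1` B) FU.
have GnB : G (~` B) by apply: sFG.
by have [y []] := filter_ex (filterI GB GnB).
Qed.

(** Compactness of [[-K, K]] makes every bounded sequence converge along the ultrafilter; as it
    refines [\oo], ordinary limits are preserved. [L] is total, and its value on an unbounded
    sequence may be a default one. *)
Lemma ultra_limit : exists L : (nat -> R) -> R,
  [/\ forall c u v, bounded_fun u -> bounded_fun v ->
        L (fun n => c * u n + v n) = c * L u + L v,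
      forall u, bounded_fun u -> (forall n, 0 <= u n) -> 0 <= L u &
      forall u (l : R), u n @[n --> \oo] --> l -> L u = l].
Proof.
have [F [FU ooF]] := @ultraFilterLemma nat \oo _.
have FP : ProperFilter F by exact: ultra_proper.
have cv u : bounded_fun u -> cvg (u @ F).
  move=> [K hK]; have := @segment_compact R (- K) K; rewrite compact_ultra.
  move=> /(_ (u @ F) (ultra_fmap u FU)); case.
    apply: (@filterS _ F _ setT) => [n _|]; last exact: filterT.
    by rewrite /= in_itv /= -ler_norml.
  by move=> p [_ hp]; apply/cvg_ex; exists p.
exists (fun u => lim (u @ F)); split.
- move=> c u v /cv hu /cv hv; apply: cvg_lim => //.
  by apply: cvgD => //; apply: cvgM => //; exact: cvg_cst.
- by move=> u /cv hu u0; apply: limr_ge => //; apply: nearW.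
- move=> u l ul; apply: cvg_lim => // B /ul uB; exact: ooF.
Qed.

End UltraLimit.

Section LimitState.
Variables (R : realType) (A : cstarAlgType R) (tau : {scalar A}).
Hypothesis htau : is_state tau.
Variable L : (nat -> R) -> R.
Hypothesis L_linear : forall c u v, bounded_fun u -> bounded_fun v ->
  L (fun n => c * u n + v n) = c * L u + L v.
Hypothesis L_ge0 : forall u, bounded_fun u -> (forall n, 0 <= u n) -> 0 <= L u.
Hypothesis L_cvg : forall u (l : R), (u n @[n --> \oo] --> l)%classic -> L u = l.

Let tau_re (u : bounded_seq A) n := complex.Re (tau (u n)).
Let tau_im (u : bounded_seq A) n := complex.Im (tau (u n)).

Let tau_re_bounded u : bounded_fun (tau_re u).
Proof.
have [K hK] := bseq_bounded u; exists K => n.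
exact: le_trans (nc_Re _) (le_trans (state_le_cnorm htau _) (hK n)).
Qed.

Let tau_im_bounded u : bounded_fun (tau_im u).
Proof.
have [K hK] := bseq_bounded u; exists K => n.
exact: le_trans (nc_Im _) (le_trans (state_le_cnorm htau _) (hK n)).
Qed.

Let L_cst (c : R) : L (fun=> c) = c.
Proof. by apply: L_cvg; exact: cvg_cst. Qed.

Let bounded_lin (c : R) (u v : nat -> R) : bounded_fun u -> bounded_fun v -> bounded_fun (fun n => c * u n + v n).
Proof.
move=> [K hK] [K' hK']; exists (`|c| * K + K') => n.
apply: le_trans (ler_normD _ _) _; rewrite normrM lerD ?hK' //.
by rewrite ler_wpM2l ?hK.
Qed.

(** Assembled from real and imaginary parts because [L] acts on real sequences. *)
Definition limit_state (u : bounded_seq A) : R[i] :=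
  L (fun n => complex.Re (tau (u n))) +i* L (fun n => complex.Im (tau (u n))).

Lemma limit_state_scalar : scalar limit_state.
Proof.
move=> c u v; rewrite /limit_state.
have eR : (fun n => complex.Re (tau ((c *: u + v) n))) =
    (fun n => complex.Re c * tau_re u n + (- complex.Im c * tau_im u n + tau_re v n)).
  apply/funext => n; rewrite /tau_re /tau_im [(c *: u + v) n]/(c *: u n + v n) stateD stateZ.
  by case: (c) (tau (u n)) (tau (v n)) => [c1 c2] [u1 u2] [v1 v2] /=; ring.
have eI : (fun n => complex.Im (tau ((c *: u + v) n))) =
    (fun n => complex.Re c * tau_im u n + (complex.Im c * tau_re u n + tau_im v n)).
  apply/funext => n; rewrite /tau_re /tau_im [(c *: u + v) n]/(c *: u n + v n) stateD stateZ.
  by case: (c) (tau (u n)) (tau (v n)) => [c1 c2] [u1 u2] [v1 v2] /=; ring.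
rewrite eR eI !L_linear //; try exact: bounded_lin.
rewrite /tau_re /tau_im; case: c {eR eI} => c1 c2 /=.
by apply/eqP; rewrite eq_complex /=; apply/andP; split; apply/eqP; ring.
Qed.

HB.instance Definition _ :=
  GRing.isLinear.Build R[i] (bounded_seq A) R[i] _ limit_state limit_state_scalar.
Definition limit_scalar : {scalar bounded_seq A} := limit_state.

Lemma limit_state_cst (u : bounded_seq A) (t : R[i]) :
  (forall n, tau (u n) = t) -> limit_state u = t.
Proof.
move=> h; rewrite /limit_state.
have -> : (fun n => complex.Re (tau (u n))) = fun=> complex.Re t by apply/funext => n; rewrite h.
have -> : (fun n => complex.Im (tau (u n))) = fun=> complex.Im t by apply/funext => n; rewrite h.
by rewrite !L_cst; case: t {h}.
Qed.

Lemma limit_state_is_state : is_state limit_scalar.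
Proof.
split=> [u|]; last by apply: limit_state_cst => n; exact: htau.2.
have e n : tau ((star u * u) n) = (sqn tau (u n))%:C by rewrite -sqnE.
rewrite lecE /=; apply/andP; split.
  have -> : (fun n => complex.Im (tau ((star u * u) n))) = fun=> 0.
    by apply/funext => n; rewrite e.
  by rewrite L_cst.
by apply: L_ge0 => [|n]; [exact: (tau_re_bounded (star u * u))|rewrite e /= sqn_ge0].
Qed.

Lemma limit_state_cvg (u : bounded_seq A) (t : R[i]) (D : R) :
  (forall n, (0 < n)%N -> nc (tau (u n) - t) <= (Num.sqrt n%:R)^-1 * D) -> limit_state u = t.
Proof.
move=> h.
have small (f : R[i] -> R) : (forall z1 z2, f z1 - f z2 = f (z1 - z2)) ->
    (forall z, `|f z| <= nc z) -> L (fun n => f (tau (u n))) = f t.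
  move=> fB fle; apply: L_cvg; apply/cvgrPdist_lt => e e0.
  have [N [N0 hN]] := inv_sqrt_small D e0; exists N => // n /= Nn.
  rewrite distrC fB; apply: le_lt_trans (fle _) _.
  by apply: le_lt_trans (h _ (leq_trans N0 Nn)) (hN _ Nn).
rewrite /limit_state (small (@complex.Re R)) ?(small (@complex.Im R)).
- by case: t {h small}.
- by move=> [? ?] [? ?].
- exact: nc_Im.
- by move=> [? ?] [? ?].
- exact: nc_Re.
Qed.

End LimitState.

(** * The central limit theorem with its rate for Cauchy transforms *)

Theorem theorem1p2 (R : realType) (A : cstarAlgType R) (tau : {scalar A})
    (htau : is_state tau) (hfaithful : is_faithful tau)
    (d : nat) (hd : (0 < d)%N) (x : nat -> 'I_d -> A)
    (hfree : free_sets tau x)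
    (hid : identically_distributed tau x)
    (hsa : forall i k, self_adjoint (x i k))
    (hnz : forall i k, x i k <> 0)
    (hcentered : forall i k, tau (x i k) = 0)
    (hbounded : exists M : R, forall i k, cnorm (x i k) <= M)
    (Sigma : 'M[R[i]]_d)
    (hSigma : forall i k l, Sigma k l = tau (x i k * x i l)) :
  (exists (B : cstarAlgType R) (phi : {scalar B}) (iota : {lrmorphism A -> B})
      (s : 'I_d -> B),
    [/\ is_state phi, is_enlargement tau phi iota
      & semicircular_family phi Sigma s]) /\
  (forall (B : cstarAlgType R) (phi : {scalar B}) (s : 'I_d -> B),
    is_state phi -> semicircular_family phi Sigma s ->
    converges_in_distribution tau phi (clt_sum x) s /\
    (forall p : ncpoly R d, exists (C r : R) (N : nat),
      [/\ 0 < C, 0 < r &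
        forall (z : R[i]) (n : nat), r%:C < `|z| -> (N <= n)%N ->
          [/\ cauchy_defined (nceval p s) z,
              cauchy_defined (nceval p (clt_sum x n)) z &
              `|cauchy_transform phi (nceval p s) z
                - cauchy_transform tau (nceval p (clt_sum x n)) z|
              <= (C * (Num.sqrt (n%:R : R))^-1)%:C]])).
Proof.
have [M0 hM0] := hbounded; pose M := Num.max M0 1.
have M_ge1 : 1 <= M by rewrite le_max lexx orbT.
have hM i k : cnorm (x i k) <= M by rewrite le_max hM0.
have err := semicircular_moment_error htau hfaithful hd hfree hsa hcentered M_ge1 hM hSigma.
(* Index 0 is included, because the whole sequence is to be an element of [bounded_seq A]. *)
have S_bound n k : cnorm (clt_sum x n k) <= 2 * M.
  have [->|n0] := posnP n; last exact: (clt_sum_cnorm htau hfaithful hfree hsa hcentered hM n0).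
  by rewrite /clt_sum big_ord0 scaler0 cnorm0 mulr_ge0 // (le_trans ler01).
split.
  have [L [L_lin L_ge0 L_cvg]] := ultra_limit R.
  have S_bd k : exists K : R, forall n, cnorm (clt_sum x n k) <= K by exists (2 * M).
  pose s k := BoundedSeq (S_bd k).
  exists (bounded_seq A), (limit_scalar htau L_lin), (@bseq_const R A : {lrmorphism _ -> _}), s.
  split; [exact: limit_state_is_state| |].
    split=> [a b /(congr1 (fun u : bounded_seq A => u 0%N)) //|a|a].
      exact: bseq_eq.
    exact: limit_state_cst.
  split=> [k|r k].
    by apply: bseq_eq => n; exact: clt_sum_self_adjoint.
  apply: (limit_state_cvg L_cvg (D := 4 * (4 * (3 * M)) ^+ r)) => n n0.
  by rewrite bseq_prod; apply: err.
move=> B phi s hphi [ssa sm]; split=> [r k|p].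
  apply/(@cvgrPdist_lt _ R[i]^o) => e e0; rewrite sm.
  (* A positive element of [R[i]] is real. *)
  have [e1 ee] : exists e1 : R, e = e1%:C.
    by exists (complex.Re e); move: e0; rewrite ltcE; case: e => ? ? /= /andP[/eqP -> _].
  have e10 : 0 < e1 by rewrite -ltcR -ee.
  have [N [N0 hN]] := inv_sqrt_small (4 * (4 * (3 * M)) ^+ r) e10.
  exists N => // n /= Nn; rewrite ee distrC normCE ltcR.
  exact: le_lt_trans (err _ _ _ (leq_trans N0 Nn)) (hN _ Nn).
have [l hl] := nceval_list p.
(* A radius that dominates the growth rate of the moment error, the norms of all [clt_sum x n k],
   and the norms of the given family [s]. *)
pose E := 4 * (3 * M) + \sum_(k < d) cnorm (s k).
have sum0 : 0 <= \sum_(k < d) cnorm (s k) by apply: sumr_ge0 => k _; exact: cnorm_ge0.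
have M0' : 0 <= M by exact: le_trans ler01 M_ge1.
have sE k : cnorm (s k) <= E.
  rewrite /E (bigD1 k) //= addrCA lerDl addr_ge0 ?mulr_ge0 //.
  by apply: sumr_ge0 => j _; exact: cnorm_ge0.
have SE n k : cnorm (clt_sum x n k) <= E.
  by apply: le_trans (S_bound n k) _; rewrite /E; lra.
have E0 : 0 <= E by rewrite addr_ge0 ?mulr_ge0.
(* 4 is the factor in [moment_error], the radius is the threshold of [cauchy_transform_diff], and
   the rate holds from [n = 1] on. *)
exists 4, (list_weight E l + 1), 1%N; split=> //.
  by rewrite ltr_wpDl // list_weight_ge0.
move=> z n zr n0; rewrite !hl.
rewrite normCE ltcR in zr.
have e0 : 0 <= 4 * (Num.sqrt (n%:R : R))^-1 by rewrite mulr_ge0 ?invr_ge0 ?sqrtr_ge0.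
have words (w : seq 'I_d) : nc (phi (\prod_(k <- w) s k) - tau (\prod_(k <- w) clt_sum x n k)) <=
    4 * (Num.sqrt (n%:R : R))^-1 * E ^+ size w.
  rewrite (big_tnth _ _ w) (big_tnth _ _ w (fun=> true) (clt_sum x n)) sm nc_B.
  apply: le_trans (err _ _ _ n0) _.
  rewrite [leLHS]mulrCA [leLHS]mulrA ler_wpM2l // lerXn2r ?nnegrE ?mulr_ge0 //.
  by rewrite /E lerDl.
have [Us Uy h] := cauchy_transform_diff htau hphi e0 (SE n) sE words (ltW zr).
by split=> //; rewrite normCE lecR.
Qed.
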